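(* Let $(X_t)_{t\ge 0}$ be a conservative continuous-time Markov process on a Polish space $E$ with invariant probability measure $\mu$, and let $L$ be the generator on $L^2(\mu)$ of its semigroup $(P_t)_{t\ge0}$, closed with domain $D(L)$ dense in $L^2(\mu)$. Assume that there exist $\rho>0$ and a bounded symmetric linear operator $S$ on $L^2(\mu)$ such that for all $f\in D(L)$, $$\|Sf\|_2\le \tfrac12\|f-\mu f\|_2,\qquad \langle f, Lf+SLf\rangle\le -\rho\,\|f-\mu f\|_2^2 .$$ Let $\nu\ll\mu$ be a probability measure on $E$ and let $V:E\to\mathbb{R}$ be a bounded measurable function. Then for all $t\ge 0$ and all $r\ge 0$, $$\mathbb{P}_\nu\left(\frac1t\int_0^t V(X_s)\,ds-\mu V\ge r\right)\le \sqrt2\,\left\|\frac{d\nu}{d\mu}\right\|_2 e^{-t\,h(r)},$$ where $$h(r)=\frac{\rho\, r^2}{25\|V\|_2^2+6\|V\|_\infty r}.$$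
   Context: $\|\cdot\|_2$ and $\langle\cdot,\cdot\rangle$ denote the usual norm and scalar product of $L^2(\mu)$; $\|\cdot\|_\infty$ is the sup norm; $\mu f=\int_E f\,d\mu$. The semigroup is $P_tf(x)=\mathbb{E}_x(f(X_t))$, regarded as a semigroup on $L^2(\mu)$, and conservative means $P_t\mathbf{1}=\mathbf{1}$. $\mathbb{P}_\nu$ is the law of the process with initial distribution $\nu$. *)

(* Defs.v *)
From HB Require Import structures.
From mathcomp Require Import all_boot all_order all_algebra.
From mathcomp Require Import all_classical all_reals all_analysis.

Set Implicit Arguments.
Unset Strict Implicit.
Unset Printing Implicit Defensive.

Import Order.TTheory GRing.Theory Num.Theory.
Import numFieldNormedType.Exports.

Local Open Scope classical_set_scope.
Local Open Scope ring_scope.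

Definition polish (R : realType) (E : topologicalType) : Prop :=
  (exists2 D : set E, countable D & dense D) /\
  exists dist : E -> E -> R,
    [/\ forall x y, dist x y = 0 <-> x = y,
        forall x y, dist x y = dist y x,
        forall x y z, dist x z <= dist x y + dist y z,
        forall (x : E) (A : set E),
          nbhs x A <-> exists2 e : R, 0 < e & [set y | dist x y < e] `<=` A
      & forall u : nat -> E,
          (forall e : R, 0 < e -> exists N : nat, forall m n : nat,
             (N <= m)%N -> (N <= n)%N -> dist (u m) (u n) < e) ->
          exists l : E, u @ \oo --> l].

Notation borel E := (g_sigma_algebraType (@open E)).

Section L2.
Context d (E : measurableType d) (R : realType) (mu : probability E R).

(* Square-integrable functions, not yet identified when they agree
   mu-almost everywhere: an operator on L^2(mu) is given below by its action on
   representatives, all identities between functions being stated mu-a.e. *)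
Definition L2 := LfunType mu (@lee1n R 2).

Definition mean (f : E -> R) : R := \int[mu]_x f x.

Definition norm2 (f : E -> R) : R := fine 'N[mu]_2%:E[EFin \o f].

Definition dot (f g : E -> R) : R := \int[mu]_x (f x * g x).

Definition centered (f : E -> R) : E -> R := fun x => f x - mean f.

Record bounded_symmetric_operator (S : L2 -> L2) : Prop := {
  bso_ae : forall f g : L2, f = g %[ae mu] -> S f = S g %[ae mu] ;
  bso_add : forall f g : L2, S (f + g) = S f + S g %[ae mu] ;
  bso_scale : forall (a : R) (f : L2), S (a *: f) = a *: S f %[ae mu] ;
  bso_bounded : exists C : R, forall f : L2, norm2 (S f) <= C * norm2 f ;
  bso_symmetric : forall f g : L2, dot (S f) g = dot f (S g) }.

End L2.

Section markov.
Context d (E : measurableType d) dW (W : measurableType dW) (R : realType).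
Variables (P : R.-pker E ~> W) (X : R -> W -> E).

(* natural filtration of the process *)
Definition past (s : R) : set (set W) :=
  <<s \bigcup_(u in `[0, s]) preimage_set_system setT (X u) measurable >>.

Record markov_process : Prop := {
  (* joint measurability makes the time integrals of V (X_s) well-defined
     random variables *)
  mp_measurable :
    measurable_fun ([set t : R | 0 <= t] `*` [set: W])
      (fun p : R * W => X p.1 p.2) ;
  mp_start : forall (x : E) (B : set E), measurable B ->
    P x (X 0 @^-1` B) = \d_x B ;
  mp_markov : forall (s t : R) (x : E) (A : set W) (B : set E),
    0 <= s -> 0 <= t -> past s A -> measurable B ->
    P x (A `&` X (s + t) @^-1` B) =
      (\int[P x]_(w in A) P (X s w) (X t @^-1` B))%E }.

Definition law (nu : probability E R) (A : set W) : \bar R :=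
  (\int[nu]_x P x A)%E.

(* For f in L^2(mu) the integral exists for mu-almost every x, by invariance;
   on the remaining null set the library's conventions give it some value *)
Definition semigroup (t : R) (f : E -> R) : E -> R :=
  fun x => \int[P x]_w f (X t w).

Definition time_average (V : E -> R) (t : R) (w : W) : R :=
  t^-1 * \int[lebesgue_measure]_(s in `[0, t]) V (X s w).

Definition conservative : Prop :=
  forall t : R, 0 <= t -> semigroup t (cst 1) = cst 1.

Variable mu : probability E R.

Definition invariant_probability : Prop :=
  forall (t : R) (B : set E), 0 <= t -> measurable B ->
    law mu (X t @^-1` B) = mu B.

(* f belongs to D(L) and Lf = g; the norm is kept in the extended reals since
   fine would turn an infinite value into 0 *)
Definition generator (f g : L2 mu) : Prop :=
  'N[mu]_2%:E[(fun x => (t^-1 * (semigroup t f x - f x) - g x)%:E)]%E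
    @[t --> 0^'+] --> 0%E.

Definition generator_domain (f : L2 mu) : Prop := exists g, generator f g.

Definition generator_dense : Prop :=
  forall (f : L2 mu) (e : R), 0 < e ->
    exists2 u : L2 mu, generator_domain u & norm2 mu (f \- u) < e.

Definition generator_closed : Prop :=
  forall (u v : nat -> L2 mu) (f g : L2 mu),
    (forall n, generator (u n) (v n)) ->
    norm2 mu (u n \- f) @[n --> \oo] --> 0 ->
    norm2 mu (v n \- g) @[n --> \oo] --> 0 ->
    generator f g.

End markov.

Definition sup_norm (R : realType) (E : Type) (V : E -> R) : R :=
  sup (range (fun x => `|V x|)).

(* With x / 0 = 0 the rate is 0 when its denominator vanishes, so that the
   exponential factor is 1 in that degenerate case *)
Definition rate d (E : measurableType d) (R : realType) (mu : probability E R)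
    (rho : R) (V : E -> R) (r : R) : R :=
  rho * r ^+ 2 / (25 * norm2 mu V ^+ 2 + 6 * sup_norm V * r).

(* Main.v *)
Require Import Defs.
From HB Require Import structures.
From mathcomp Require Import all_boot all_order all_algebra.
From mathcomp Require Import all_classical all_reals all_analysis.
From mathcomp Require Import measurable_realfun.
From mathcomp Require Import ring lra.

Set Implicit Arguments.
Unset Strict Implicit.
Unset Printing Implicit Defensive.

Import Order.TTheory GRing.Theory Num.Theory.
Import numFieldNormedType.Exports.

Local Open Scope classical_set_scope.
Local Open Scope charge_scope.
Local Open Scope ring_scope.


(** Write S for the bounded operator and <f, g> for the scalar product of
    L^2(mu). The two hypotheses on S say that S kills constants and that
    B(f, g) = <f, (1 + S) g> is a scalar product equivalent to <f, g>, with
    <f, f> <= 2 B(f, f), for which the generator is coercive on centered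
    functions: B(f, Lf) <= - rho Var f. Differentiating the Feynman-Kac
    functional u_t(x) = E_x [exp (int_0^t v(X_s) ds)], where v is a multiple
    lambda (V - mu V) of the centered observable, gives
      (B(u, u))' / 2 = B(u, Lu) + B(u, v u) <= Lambda B(u, u)
    as soon as B(u, v u) <= rho Var u + Lambda (mu u)^2. Hence the norm of u_t
    is at most sqrt 2 exp(Lambda t), and the theorem is Chernoff's bound with
    the change of initial distribution paid by the Cauchy-Schwarz inequality.

    The proof below follows this computation on a time grid of mesh h, which
    spares the study of the domain of L + v.

    - [dissipation] integrates coercivity along the semigroup:
      B(P_h f, P_h f) + 2 h rho Var(P_h f) <= B(f, f). The variance is taken at
      the end of the interval, where it is smallest; this implicit form holds
      for every f in L^2(mu), without any smoothness.
    - [perturbed_step] deduces that f |-> (1 + h v + O(h^2)) P_h f multiplies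
      B(f, f) by at most 1 + 2 h Lambda + O(h^2).
    - [integral_grid_prod] is the Markov property: the expectation of a product
      of functions of the process along a grid is an iterate of such steps.
    - [expR_integral_le] is Jensen's inequality: the exponential of
      int_0^t v(X_s) ds is at most the average, over the offset of the grid, of
      the exponentials of the Riemann sums. So discretizing in time costs
      nothing, although v is only measurable.
    - [law_deviation_le] collects these bounds and lets the mesh tend to 0. *)

(** * Symmetric bilinear forms *)

Section forms.
Variables (R : realType) (V : lmodType R).

Record symmetric_bilinear (b : V -> V -> R) : Prop := {
  sf_sym : forall f g, b f g = b g f ;
  sf_add : forall f g h, b (f + g) h = b f h + b g h ;
  sf_scale : forall a f h, b (a *: f) h = a * b f h }.

Section theory.
Variables (b : V -> V -> R) (sfb : symmetric_bilinear b).

Lemma sf_addr f g h : b h (f + g) = b h f + b h g.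
Proof. by rewrite sf_sym// sf_add// !(sf_sym sfb h). Qed.

Lemma sf_scaler a f h : b h (a *: f) = a * b h f.
Proof. by rewrite sf_sym// sf_scale// (sf_sym sfb h). Qed.

Lemma sf_opp f h : b (- f) h = - b f h.
Proof. by rewrite -scaleN1r sf_scale// mulN1r. Qed.

Lemma sf_oppr f h : b h (- f) = - b h f.
Proof. by rewrite -scaleN1r sf_scaler// mulN1r. Qed.

Definition sfE := (sf_addr, sf_add sfb, sf_scaler, sf_scale sfb, sf_opp,
  sf_oppr).

Hypothesis b_ge0 : forall f, 0 <= b f f.

Lemma cauchy_schwarz f g : b f g ^+ 2 <= b f f * b g g.
Proof.
have [gg0|gg_gt0] := leP (b g g) 0.
  have g0 : b g g = 0 by apply/eqP; rewrite eq_le gg0 b_ge0.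
  rewrite g0 mulr0.
  have [->|fg0] := eqVneq (b f g) 0; first by rewrite expr0n.
  (* if b g g = 0, the form at f + s *: g is affine in s; unless b f g = 0, it
     takes the value -1 at this s *)
  have := b_ge0 (f + (- (b f f + 1) / (2 * b f g)) *: g).
  rewrite !sfE g0 (sf_sym sfb g f) !mulr0 addr0.
  set s := _ / _.
  have -> : b f f + s * b f g + s * b f g = -1.
    by rewrite /s; field.
  by rewrite lerNr oppr0 ler10.
have := b_ge0 (b g g *: f - b f g *: g).
rewrite !sfE (sf_sym sfb g f).
rewrite (_ : _ + _ = b g g * (b f f * b g g - b f g ^+ 2)); last by ring.
by rewrite pmulr_rge0// subr_ge0.
Qed.

Definition seminorm f := Num.sqrt (b f f).

Lemma seminorm_ge0 f : 0 <= seminorm f.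
Proof. exact: sqrtr_ge0. Qed.

Lemma seminorm_sqr f : seminorm f ^+ 2 = b f f.
Proof. by rewrite sqr_sqrtr. Qed.

Lemma seminorm_cs f g : `|b f g| <= seminorm f * seminorm g.
Proof.
rewrite -ler_sqr ?nnegrE ?mulr_ge0 ?seminorm_ge0//.
by rewrite real_normK ?num_real// exprMn !seminorm_sqr cauchy_schwarz.
Qed.

Lemma seminormD f g : seminorm (f + g) <= seminorm f + seminorm g.
Proof.
rewrite -ler_sqr ?nnegrE ?addr_ge0 ?seminorm_ge0//.
rewrite seminorm_sqr !sfE (sf_sym sfb g f) sqrrD !seminorm_sqr.
have := le_trans (ler_norm _) (seminorm_cs f g); lra.
Qed.

Lemma seminormZ a f : seminorm (a *: f) = `|a| * seminorm f.
Proof.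
by rewrite /seminorm !sfE mulrA -expr2 sqrtrM ?sqr_ge0// sqrtr_sqr.
Qed.

(** Plays the role of equality almost everywhere: the square-integrable
    functions are not identified when they agree almost everywhere, so [b] is
    only positive semidefinite. *)
Definition indistinguishable f g := b (f - g) (f - g) = 0.

Lemma ind_form f g h : indistinguishable f g -> b f h = b g h.
Proof.
move=> fg; apply/eqP; rewrite -subr_eq0 -sf_opp// -(sf_add sfb) -normr_le0.
by rewrite (le_trans (seminorm_cs _ _))// /seminorm fg sqrtr0 mul0r.
Qed.

Lemma ind_formr f g h : indistinguishable f g -> b h f = b h g.
Proof. by move=> fg; rewrite (sf_sym sfb) (ind_form h fg) (sf_sym sfb). Qed.

Lemma ind_sqr f g : indistinguishable f g -> b f f = b g g.
Proof. by move=> fg; rewrite (ind_form f fg) (ind_formr _ fg). Qed.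

Lemma ind_seminorm f g : indistinguishable f g -> seminorm f = seminorm g.
Proof. by rewrite /seminorm => /ind_sqr ->. Qed.

Lemma indP f g : indistinguishable f g <-> forall h, b f h = b g h.
Proof.
split=> [fg h|fg]; first exact: ind_form.
by rewrite /indistinguishable (sf_add sfb) sf_opp fg subrr.
Qed.

End theory.
End forms.

(** * The modified scalar product and the dissipation inequality *)

(** [q] is the scalar product of L^2(mu), [s f g] stands for <f, S g>, and [e]
    for the constant function 1. *)
Section modified_form.
Variables (R : realType) (V : lmodType R) (q s : V -> V -> R) (e : V).
Hypotheses (sfq : symmetric_bilinear q) (q_ge0 : forall f, 0 <= q f f).
Hypothesis qee : q e e = 1.

Definition avg f := q e f.
Definition var f := q f f - avg f ^+ 2.
(** The scalar product <f, (1 + S) g>, in which the generator is coercive. *)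
Definition modified f g := q f g + s f g.

Local Notation nrm := (seminorm q).
Local Notation B := modified.

Lemma avg2_le f : avg f ^+ 2 <= q f f.
Proof. by have := cauchy_schwarz sfq q_ge0 e f; rewrite qee mul1r. Qed.

Lemma var_ge0 f : 0 <= var f.
Proof. by rewrite subr_ge0 avg2_le. Qed.

Lemma avg_center f : avg (f - avg f *: e) = 0.
Proof. by rewrite /avg !(sfE sfq) qee mulr1 subrr. Qed.

Lemma sqr_center f : q (f - avg f *: e) (f - avg f *: e) = var f.
Proof.
rewrite /var /avg !(sfE sfq) qee (sf_sym sfq f e); ring.
Qed.

Lemma seminorm_center f : nrm (f - avg f *: e) = Num.sqrt (var f).
Proof. by rewrite /seminorm sqr_center. Qed.

Lemma sqrt_var_le f : Num.sqrt (var f) <= nrm f.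
Proof. by rewrite ler_wsqrtr// gerBl sqr_ge0. Qed.

Lemma ind_var f g : indistinguishable q f g -> var f = var g.
Proof.
by move=> fg; rewrite /var /avg (ind_sqr sfq q_ge0 fg) (ind_formr sfq q_ge0 _ fg).
Qed.

(** A second form bounded by the norm, so that [var] is continuous. *)
Definition cov f g := q f g - avg f * avg g.

Lemma covE f : cov f f = var f.
Proof. by rewrite /cov /var expr2. Qed.

Lemma sf_cov : symmetric_bilinear cov.
Proof.
split=> [f g|f g h|a f h]; rewrite /cov /avg ?(sfE sfq);
  [|by ring|by ring].
by rewrite (sf_sym sfq f) mulrC.
Qed.

Lemma cov_le f g : `|cov f g| <= 3 / 2 * (nrm f * nrm g).
Proof.
have cov_ge0 u : 0 <= cov u u by rewrite covE var_ge0.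
rewrite (le_trans (seminorm_cs sf_cov cov_ge0 f g))// /seminorm !covE.
rewrite (le_trans (ler_pM _ _ (sqrt_var_le f) (sqrt_var_le g))) ?sqrtr_ge0//.
by rewrite ler_peMl ?mulr_ge0 ?seminorm_ge0//; lra.
Qed.

Hypothesis sfs : symmetric_bilinear s.
Hypothesis s_le : forall f g,
  `|s f g| <= 2^-1 * (Num.sqrt (var f) * Num.sqrt (var g)).

Lemma sf_modified : symmetric_bilinear B.
Proof.
split=> [f g|f g h|a f h]; rewrite /B.
- by rewrite (sf_sym sfq) (sf_sym sfs).
- by rewrite (sf_add sfq) (sf_add sfs); ring.
- by rewrite (sf_scale sfq) (sf_scale sfs); ring.
Qed.

Lemma modified_unit f : B e f = avg f.
Proof.
rewrite /B; suff -> : s e f = 0 by rewrite addr0.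
apply/eqP; rewrite -normr_le0 (le_trans (s_le _ _))//.
by rewrite /var /avg qee expr1n subrr sqrtr0 mul0r mulr0.
Qed.

Lemma modified_le f g : `|B f g| <= 3 / 2 * (nrm f * nrm g).
Proof.
rewrite /B (le_trans (ler_normD _ _))//.
rewrite (_ : 3 / 2 * _ = nrm f * nrm g + 2^-1 * (nrm f * nrm g)); last by field.
rewrite lerD ?seminorm_cs// (le_trans (s_le _ _))// ler_pM2l//.
by rewrite ler_pM ?sqrtr_ge0 ?sqrt_var_le.
Qed.

(** [s] only sees centered parts, and takes away at most half of the variance. *)
Lemma modified_ge f : avg f ^+ 2 + 2^-1 * var f <= B f f.
Proof.
have := s_le f f; rewrite -expr2 sqr_sqrtr ?var_ge0// ler_norml => /andP[+ _].
rewrite /B /var; lra.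
Qed.

Lemma avg2_le_modified f : avg f ^+ 2 <= B f f.
Proof. by have := modified_ge f; have := var_ge0 f; lra. Qed.

(** This is where the factor [Num.sqrt 2] of the theorem comes from. *)
Lemma sqr_le_modified f : q f f <= 2 * B f f.
Proof. by have := modified_ge f; have := sqr_ge0 (avg f); rewrite /var; lra. Qed.

Lemma modified_le_sqr f : B f f <= 3 / 2 * q f f.
Proof.
by rewrite (le_trans (ler_norm _))// (le_trans (modified_le _ _))// -expr2
  seminorm_sqr.
Qed.

Lemma ind_modified f g : indistinguishable q f g -> forall h, B f h = B g h.
Proof.
move=> fg h; apply/eqP; rewrite -subr_eq0 -(sf_opp sf_modified).
rewrite -(sf_add sf_modified) -normr_le0 (le_trans (modified_le _ _))//.
by rewrite /seminorm fg sqrtr0 mul0r mulr0.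
Qed.

Lemma ind_modified_sqr f g : indistinguishable q f g -> B f f = B g g.
Proof.
move=> fg; rewrite (ind_modified fg) (sf_sym sf_modified).
by rewrite (ind_modified fg).
Qed.

Section dynamics.
Variable T : R -> V -> V.
Local Notation "f ~~ g" := (indistinguishable q f g) (at level 70).
Hypothesis T_add : forall t f g, 0 <= t -> T t (f + g) ~~ T t f + T t g.
Hypothesis T_scale : forall t a f, 0 <= t -> T t (a *: f) ~~ a *: T t f.
Hypothesis T_contraction : forall t f, 0 <= t -> q (T t f) (T t f) <= q f f.
Hypothesis T_semigroup : forall t u f, 0 <= t -> 0 <= u ->
  T (t + u) f ~~ T t (T u f).
Hypothesis T_0 : forall f, T 0 f ~~ f.
Hypothesis T_unit : forall t, 0 <= t -> T t e ~~ e.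

Lemma form_eqP f g : f ~~ g <-> forall h, q f h = q g h.
Proof. exact: indP. Qed.

Lemma T_linear t a f g h : 0 <= t ->
  q (T t (a *: f + g)) h = a * q (T t f) h + q (T t g) h.
Proof.
move=> t0; rewrite ((form_eqP _ _).1 (T_add _ _ t0)) (sf_add sfq).
by rewrite ((form_eqP _ _).1 (T_scale _ _ t0)) (sf_scale sfq).
Qed.

Lemma T_linearr t a f g h : 0 <= t ->
  q h (T t (a *: f + g)) = a * q h (T t f) + q h (T t g).
Proof. by move=> t0; rewrite !(sf_sym sfq h) T_linear. Qed.

Lemma seminorm_T t f : 0 <= t -> nrm (T t f) <= nrm f.
Proof. by move=> t0; rewrite ler_wsqrtr// T_contraction. Qed.

(** Contractivity at [a *: f + e] for all [a] of either sign forces the term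
    linear in [a] to vanish. *)
Lemma avg_T t f : 0 <= t -> avg (T t f) = avg f.
Proof.
move=> t0; rewrite /avg.
have key a : 2 * a * (q e (T t f) - q e f) <= a ^+ 2 * (q f f - q (T t f) (T t f)).
  have := T_contraction (a *: f + e) t0.
  rewrite T_linear// !T_linearr// !((form_eqP _ _).1 (T_unit t0)).
  rewrite !(sf_sym sfq _ (T t e)) !((form_eqP _ _).1 (T_unit t0)).
  rewrite !(sfE sfq) (sf_sym sfq f e) qee; lra.
set d := q e (T t f) - q e f in key *.
set c := q f f - _ in key.
have c0 : 0 <= c by rewrite subr_ge0 T_contraction.
have c1 : 0 < c + 1 by lra.
have := key (d / (c + 1)).
have -> : 2 * (d / (c + 1)) * d = 2 * d ^+ 2 / (c + 1) by field; lra.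
have -> : (d / (c + 1)) ^+ 2 * c = d ^+ 2 / (c + 1) * (c / (c + 1)).
  by field; lra.
move=> h; have d2 : d ^+ 2 / (c + 1) <= 0.
  have : d ^+ 2 / (c + 1) * (c / (c + 1)) <= d ^+ 2 / (c + 1) * 1.
    rewrite ler_wpM2l//; first by rewrite divr_ge0 ?sqr_ge0// ltW.
    by rewrite ler_pdivrMr// mul1r lerDl.
  by move: h; rewrite mulr1; lra.
move: d2; rewrite pmulr_lle0 ?invr_gt0// => d2.
have : d = 0 by apply/eqP; rewrite -sqrf_eq0 eq_le d2 sqr_ge0.
by rewrite /d; lra.
Qed.

Lemma var_T t f : 0 <= t -> var (T t f) <= var f.
Proof. by move=> t0; rewrite /var avg_T// lerD2r T_contraction. Qed.

(** The reason why the dissipation over an interval can be estimated by the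
    variance at its end. *)
Lemma var_T_decr t u f : 0 <= t -> t <= u -> var (T u f) <= var (T t f).
Proof.
move=> t0 tu; have ut : 0 <= u - t by rewrite subr_ge0.
by rewrite -{1}(subrK t u) (ind_var (T_semigroup f ut t0)) var_T.
Qed.

(** [D f g] plays the role of: f is in the domain and g = Lf. *)
Variable D : V -> V -> Prop.
Hypothesis D_approx : forall f g, D f g <-> forall d : R, 0 < d ->
  exists2 a : R, 0 < a &
    forall h : R, 0 < h -> h < a -> nrm (h^-1 *: (T h f - f) - g) <= d.
Variable rho : R.
Hypothesis rho_ge0 : 0 <= rho.
Hypothesis D_dissipative : forall f g, D f g -> B f g <= - rho * var f.

(** The semigroup maps the defect of the first-order expansion at time 0 to the
    defect at time t, so the expansion is uniform in time. *)
Lemma expansion_T t h f g : 0 <= t -> 0 < h ->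
  nrm (h^-1 *: (T h (T t f) - T t f) - T t g) <=
  nrm (h^-1 *: (T h f - f) - g).
Proof.
move=> t0 h0; rewrite (le_trans _ (seminorm_T _ t0))// le_eqVlt; apply/orP; left.
apply/eqP/(ind_seminorm sfq q_ge0)/form_eqP => k.
have -> : h^-1 *: (T h f - f) - g = h^-1 *: ((-1) *: f + T h f) + (-1) *: g.
  by rewrite !scaleN1r [- f + _]addrC.
rewrite !T_linear// ((form_eqP _ _).1 (T_scale _ _ t0)) !(sfE sfq).
have hh := ltW h0.
rewrite -((form_eqP _ _).1 (T_semigroup _ hh t0)).
rewrite -((form_eqP _ _).1 (T_semigroup _ t0 hh)) [h + t]addrC.
ring.
Qed.

Lemma D_T t f g : 0 <= t -> D f g -> D (T t f) (T t g).
Proof.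
move=> t0 /D_approx fg; apply/D_approx => d /fg[a a0 ha]; exists a => // h h0 hlt.
by rewrite (le_trans (expansion_T _ _ t0 h0))// ha.
Qed.

(** Expansion of [B] at [T t f + h *: (T t g + r)] with [nrm r <= d]: the term
    of order [h] is controlled by [D_dissipative]. *)
Lemma modified_step t h d f g : 0 <= t -> 0 < h -> 0 <= d -> D f g ->
  nrm (h^-1 *: (T h f - f) - g) <= d ->
  B (T (t + h) f) (T (t + h) f) <= B (T t f) (T t f) - 2 * h * rho * var (T t f)
    + h * (3 * nrm f * d + 3 / 2 * h * (nrm g + d) ^+ 2).
Proof.
move=> t0 h0 d0 Dfg fgd.
have hd := le_trans (expansion_T f g t0 h0) fgd.
have := D_dissipative (D_T t0 Dfg).
have ft := seminorm_T f t0; have gt := seminorm_T g t0.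
rewrite (addrC t) (ind_modified_sqr (T_semigroup f (ltW h0) t0)).
set f' := T t f in hd ft *; set g' := T t g in hd gt *.
set r := _ - g' in hd.
have -> : T h f' = f' + h *: (g' + r).
  by rewrite /r [g' + _]addrC subrK scalerA divff ?gt_eqF// scale1r addrC subrK.
have sB := sf_modified.
rewrite (sf_add sB) !(sf_addr sB) (sf_scale sB) !(sf_scaler sB).
rewrite (sf_scale sB) (sf_sym sB (g' + r) f') (sf_addr sB g' r f').
have b1 : B f' r <= 3 / 2 * nrm f * d.
  rewrite (le_trans (ler_norm _))// (le_trans (modified_le _ _))// -[leRHS]mulrA.
  by rewrite ler_pM2l// ler_pM ?seminorm_ge0.
have b2 : B (g' + r) (g' + r) <= 3 / 2 * (nrm g + d) ^+ 2.
  rewrite (le_trans (modified_le_sqr _))// ler_pM2l//.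
  rewrite -seminorm_sqr// ler_sqr ?nnegrE ?addr_ge0 ?seminorm_ge0//.
  by rewrite (le_trans (seminormD sfq q_ge0 _ _))// lerD.
have := ler_wpM2l (ltW h0) b1.
have := ler_wpM2l (mulr_ge0 (ltW h0) (ltW h0)) b2.
move=> hb2 hb1 hb3; have := ler_wpM2l (ltW h0) hb3.
by lra.
Qed.

Lemma modified_steps (n : nat) (h d : R) f g : 0 < h -> 0 <= d -> D f g ->
  nrm (h^-1 *: (T h f - f) - g) <= d ->
  B (T (n%:R * h) f) (T (n%:R * h) f)
    + 2 * (n%:R * h) * rho * var (T (n%:R * h) f) <=
  B f f + n%:R * h * (3 * nrm f * d + 3 / 2 * h * (nrm g + d) ^+ 2).
Proof.
move=> h0 d0 Dfg fgd; set err := 3 * _ * d + _.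
elim: n => [|n IH].
  by rewrite !mul0r mulr0 !mul0r !addr0 (ind_modified_sqr (T_0 f)).
have nh : 0 <= n%:R * h by rewrite mulr_ge0// ltW.
have := modified_step nh h0 d0 Dfg fgd.
rewrite -/err -[n.+1%:R]natr1 [(n%:R + 1) * h]mulrDl mul1r.
have := var_T_decr f nh (_ : n%:R * h <= n%:R * h + h).
rewrite lerDl => /(_ (ltW h0)) vd.
have := ler_wpM2l (mulr_ge0 rho_ge0 (addr_ge0 nh (ltW h0))) vd.
by move: IH; lra.
Qed.

(** Summing [modified_step] over a subdivision of [0, t], whose error vanishes
    with the mesh, replaces the differentiation of [B (T t f) (T t f)]. *)
Lemma dissipation_domain t f g : 0 < t -> D f g ->
  B (T t f) (T t f) + 2 * t * rho * var (T t f) <= B f f.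
Proof.
move=> t0 Dfg; apply/ler_addgt0Pr => eta eta0.
pose c := 3 * nrm f + 3 / 2 * (nrm g + 1) ^+ 2 + 1.
have f0 : 0 <= nrm f := seminorm_ge0 q f.
have c0 : 0 < c by have := sqr_ge0 (nrm g + 1); rewrite /c; lra.
pose d := Num.min 1 (eta / (t * c)).
have d0 : 0 < d by rewrite lt_min ltr01/= divr_gt0// mulr_gt0.
have [a a0 ha] := (D_approx f g).1 Dfg d d0.
have [n nP] : exists n, t / Num.min a d < n.+1%:R.
  by exists (Num.trunc (t / Num.min a d)); rewrite truncnS_gt.
have ad0 : 0 < Num.min a d by rewrite lt_min a0.
pose h := t / n.+1%:R.
have h0 : 0 < h by rewrite divr_gt0.
have had : h < Num.min a d by rewrite ltr_pdivrMr// mulrC -ltr_pdivrMr.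
move: had; rewrite lt_min => /andP[hlta hltd].
have := modified_steps n.+1 h0 (ltW d0) Dfg (ha _ h0 hlta).
have -> : n.+1%:R * h = t by rewrite /h mulrCA divff ?mulr1// pnatr_eq0.
move=> /le_trans; apply; rewrite lerD2l.
have d1 : d <= 1 by rewrite ge_min lexx.
have deta : t * c * d <= eta.
  by rewrite mulrC -ler_pdivlMr ?mulr_gt0// ge_min lexx orbT.
rewrite (le_trans _ deta)// -[leRHS]mulrA ler_pM2l// /c.
have g0 : 0 <= nrm g := seminorm_ge0 q g.
have : (nrm g + d) ^+ 2 <= (nrm g + 1) ^+ 2.
  by rewrite ler_sqr ?nnegrE ?addr_ge0 ?lerD2l// ltW.
move=> sq; have : h * (nrm g + d) ^+ 2 <= d * (nrm g + 1) ^+ 2.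
  by rewrite ler_pM ?sqr_ge0// ltW.
lra.
Qed.

Hypothesis D_dense : forall f (d : R), 0 < d ->
  exists2 u, exists g, D u g & nrm (f - u) < d.

Lemma seminorm_subT t f u : 0 <= t -> nrm (T t f - T t u) <= nrm (f - u).
Proof.
move=> t0; rewrite (le_trans _ (seminorm_T _ t0))// le_eqVlt; apply/orP; left.
apply/eqP/(ind_seminorm sfq q_ge0)/form_eqP => k.
have -> : f - u = (-1) *: u + f by rewrite scaleN1r addrC.
by rewrite T_linear// !(sfE sfq); ring.
Qed.

(** A quantitative form of the continuity of a bounded quadratic form. *)
Lemma quadratic_near (b : V -> V -> R) f u (d : R) : symmetric_bilinear b ->
  (forall f g, `|b f g| <= 3 / 2 * (nrm f * nrm g)) ->
  0 <= d -> d <= 1 -> nrm (f - u) <= d ->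
  b f f <= b u u + d * (3 * (nrm u + 1)).
Proof.
move=> sb b_le d0 d1 fu; rewrite -{1 2}(subrK u f).
move: (f - u) fu => w fu.
rewrite (sf_add sb) !(sf_addr sb) (sf_sym sb u w).
have := le_trans (ler_norm _) (b_le w u).
have := le_trans (ler_norm _) (b_le w w).
have w0 : 0 <= nrm w := seminorm_ge0 q w.
have u0 : 0 <= nrm u := seminorm_ge0 q u.
have : nrm w * nrm u <= d * nrm u by rewrite ler_wpM2r.
have : nrm w * nrm w <= d.
  by rewrite (le_trans (ler_pM w0 w0 fu fu))// ler_piMr.
lra.
Qed.

(** Both sides are continuous in [f], and the domain is dense. *)
Lemma dissipation t f : 0 < t ->
  B (T t f) (T t f) + 2 * t * rho * var (T t f) <= B f f.
Proof.
move=> t0; apply/ler_addgt0Pr => eta eta0; have t0' := ltW t0.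
have f0 : 0 <= nrm f := seminorm_ge0 q f.
have tr0 : 0 <= t * rho by rewrite mulr_ge0.
pose c := (2 + 2 * (t * rho)) * (3 * (nrm f + 2)).
have c0 : 0 < c by rewrite /c; apply: mulr_gt0; lra.
pose d := Num.min 1 (eta / c).
have d0 : 0 < d by rewrite lt_min ltr01/= divr_gt0.
have d0' := ltW d0.
have d1 : d <= 1 by rewrite ge_min lexx.
have [u [g Dug] ufd] := D_dense f d0.
have := dissipation_domain t0 Dug.
have fu := ltW ufd.
have uf : nrm (u - f) <= d by rewrite -opprB -scaleN1r seminormZ// normrN1 mul1r.
have Tfu := le_trans (seminorm_subT f u t0') fu.
have uf1 : nrm u <= nrm f + 1.
  have := seminormD sfq q_ge0 (u - f) f; rewrite subrK; lra.
have Tu : nrm (T t u) <= nrm f + 1 by rewrite (le_trans (seminorm_T _ t0')).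
have h1 := quadratic_near sf_modified modified_le d0' d1 Tfu.
have h2 := quadratic_near sf_modified modified_le d0' d1 uf.
have h3 := quadratic_near sf_cov cov_le d0' d1 Tfu.
rewrite !covE in h3.
have k1 : d * (3 * (nrm (T t u) + 1)) <= d * (3 * (nrm f + 2)).
  by rewrite ler_pM2l// ler_pM2l//; lra.
have k2 : d * (3 * (nrm f + 1)) <= d * (3 * (nrm f + 2)).
  by rewrite ler_pM2l// ler_pM2l//; lra.
have k3 : d * c <= eta by rewrite -ler_pdivlMr// ge_min lexx orbT.
have h4 := ler_wpM2l tr0 (le_trans h3 (lerD (lexx _) k1)).
by move: k3; rewrite /c; lra.
Qed.

(** [M] is the multiplication by a bounded function of mean zero; [sig] and [k]
    bound its L^2 and sup norms. *)
Section perturbation.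
Variables (M : V -> V) (sig k Lam : R).
Hypothesis M_sym : forall f g, q (M f) g = q f (M g).
Hypothesis M_avg : avg (M e) = 0.
Hypothesis M_unit : nrm (M e) <= sig.
Hypothesis M_norm : forall f, nrm (M f) <= k * nrm f.
Hypothesis k_ge0 : 0 <= k.
Hypothesis Lam_ge0 : 0 <= Lam.
(* x stands for the mean of a function and y for its standard deviation *)
Hypothesis rate_le : forall x y : R, 0 <= x -> 0 <= y ->
  5 / 2 * sig * (x * y) + 3 / 2 * k * y ^+ 2 <= rho * y ^+ 2 + Lam * x ^+ 2.

(** A function is split into its mean and its centered part. The square of the
    mean contributes nothing, since the perturbation has mean zero. *)
Lemma perturbation_form f : B f (M f) <= rho * var f + Lam * avg f ^+ 2.
Proof.
have w_var := seminorm_center f; have w_avg := avg_center f.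
have fE : f = avg f *: e + (f - avg f *: e) by rewrite addrC subrK.
move: (f - avg f *: e) w_var w_avg fE => w w_var w_avg fE.
have ME h : q (M f) h = q (avg f *: M e + M w) h.
  by rewrite M_sym {1}fE (sf_add sfq) (sf_scale sfq) !(sfE sfq) !M_sym.
have sB := sf_modified.
have -> : B f (M f) = avg f * q (M e) w + avg f * B w (M e) + B w (M w).
  rewrite (sf_sym sB) (ind_modified ((form_eqP _ _).2 ME)).
  rewrite {2}fE !(sfE sB) !(sf_sym sB _ e) !modified_unit M_avg.
  by rewrite (sf_sym sB (M e)) (sf_sym sB (M w)) /avg -M_sym; ring.
have y0 := sqrtr_ge0 (var f).
have := rate_le (normr_ge0 (avg f)) y0.
rewrite sqr_sqrtr ?var_ge0// real_normK ?num_real//.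
apply: le_trans; rewrite -w_var in y0 *.
have e1 : avg f * q (M e) w <= sig * (`|avg f| * nrm w).
  rewrite (le_trans (ler_norm _))// normrM mulrCA ler_wpM2l//.
  by rewrite (le_trans (seminorm_cs sfq q_ge0 _ _))// ler_wpM2r.
have e2 : avg f * B w (M e) <= 3 / 2 * sig * (`|avg f| * nrm w).
  rewrite (le_trans (ler_norm _))// normrM [leRHS]mulrCA ler_wpM2l//.
  rewrite (le_trans (modified_le _ _))// -[leRHS]mulrA ler_pM2l// mulrC.
  by rewrite ler_wpM2r.
have e3 : B w (M w) <= 3 / 2 * k * var f.
  rewrite -[var f]sqr_sqrtr ?var_ge0// -w_var.
  rewrite (le_trans (ler_norm _))// (le_trans (modified_le _ _))//.
  rewrite -[leRHS]mulrA ler_pM2l// [leRHS]mulrC expr2 -[leRHS]mulrA.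
  by rewrite ler_wpM2l// mulrC.
have -> : 5 / 2 * sig * (`|avg f| * nrm w) =
  sig * (`|avg f| * nrm w) + 3 / 2 * sig * (`|avg f| * nrm w) by field.
by rewrite !lerD.
Qed.

(** One step of the product formula for the perturbed semigroup: the decay at
    the end of [T h] absorbs the growth created by the multiplication. *)
Lemma perturbed_step h a f : 0 < h -> 1 <= a ->
  let g := a *: T h f + h *: M (T h f) in
  B g g <= (a ^+ 2 + 2 * a * h * Lam + 3 * k ^+ 2 * h ^+ 2) * B f f.
Proof.
move=> h0 a1 /=; have a0 : 0 <= a by rewrite (le_trans ler01).
have := dissipation f h0.
have := perturbation_form (T h f).
have := avg2_le_modified (T h f).
have v0 := var_ge0 (T h f).
move: (T h f) v0 => u v0 uavg uM uf.
have sB := sf_modified.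
rewrite (sf_add sB) !(sf_addr sB) !(sf_scale sB) !(sf_scaler sB).
rewrite (sf_sym sB (M u) u).
(* the term of order h^2 *)
have MM : B (M u) (M u) <= 3 * k ^+ 2 * B u u.
  rewrite (le_trans (modified_le_sqr _))//.
  have : q (M u) (M u) <= k ^+ 2 * q u u.
    rewrite -!seminorm_sqr// -exprMn ler_sqr ?nnegrE ?mulr_ge0 ?seminorm_ge0//.
  have := ler_wpM2l (sqr_ge0 k) (sqr_le_modified u).
  lra.
have hv0 : 0 <= 2 * h * rho * var u by rewrite !mulr_ge0// ltW.
have uf' : B u u <= B f f by lra.
have m1 := ler_wpM2l (sqr_ge0 h) (le_trans MM (ler_wpM2l (mulr_ge0 (ler0n _ 3) (sqr_ge0 k)) uf')).
have m2 := ler_wpM2l (mulr_ge0 a0 (ltW h0)) uM.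
have m3 := ler_wpM2l (sqr_ge0 a) uf.
have m4 : a * (2 * h * rho * var u) <= a ^+ 2 * (2 * h * rho * var u).
  by rewrite ler_wpM2r// expr2 ler_peMl.
have m5 := ler_wpM2l (mulr_ge0 (mulr_ge0 a0 (ltW h0)) Lam_ge0) (le_trans uavg uf').
by lra.
Qed.

End perturbation.
End dynamics.
End modified_form.

(** * Mixtures of measures *)

(** The factor [y] may be infinite. *)
Lemma limeMl_ge0 (R : realType) (y : \bar R) (u : nat -> \bar R) :
  (0 <= y)%E -> (forall n, (0 <= u n)%E) -> nondecreasing_seq u ->
  limn (fun n => (y * u n)%E) = (y * limn u)%E.
Proof.
move=> y0 u0 ndu; have cu := ereal_nondecreasing_is_cvgn ndu.
have u_lim n : (u n <= limn u)%E.
  by rewrite (cvg_lim _ (ereal_nondecreasing_cvgn ndu))// ereal_sup_ubound//; exists n.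
have lim0 : (0 <= limn u)%E by exact: le_trans (u0 0) (u_lim 0).
have [->|yn0] := eqVneq y 0%E.
  by under eq_fun do rewrite mul0e; rewrite lim_cst// mul0e.
have [l0|ln0] := eqVneq (limn u) 0%E.
  rewrite l0 mule0; under eq_fun => n.
    have -> : u n = 0%E by apply/eqP; rewrite eq_le u0 -l0 u_lim.
    rewrite mule0; over.
  by rewrite lim_cst.
have cy : limn (fun=> y) = y by rewrite lim_cst.
rewrite -{2}cy -limeM//; first exact: is_cvg_cst.
rewrite cy; move: y0 yn0 lim0 ln0; rewrite /mule_def.
by case: y {cy} => [?||]; case: (limn u).
Qed.

(** The measure with weight [Y w] on [k w], averaged over [m]. All the
    identities for the process are given on events; comparing two mixtures
    extends them to nonnegative functions. *)
Section mixture.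
Context d d' (T : measurableType d) (W : measurableType d') (R : realType).
Variables (m : {measure set W -> \bar R}) (Y : W -> \bar R).
Variable k : W -> {measure set T -> \bar R}.
Hypotheses (Y0 : forall w, (0 <= Y w)%E) (mY : measurable_fun setT Y).
Hypothesis mk : forall B, measurable B -> measurable_fun setT (k^~ B).
Local Open Scope ereal_scope.

Let mYk B : measurable B -> measurable_fun setT (fun w => Y w * k w B).
Proof. by move=> mB; apply: emeasurable_funM => //; exact: mk. Qed.

Lemma measurable_fun_mixture (f : T -> \bar R) : (forall x, 0 <= f x) ->
  measurable_fun setT f ->
  measurable_fun setT (fun w => Y w * \int[k w]_x f x).
Proof.
by move=> f0 mf; apply: emeasurable_funM => //; exact: measurable_fun_integral_kernel.
Qed.

Lemma ex_mixture : exists M : {measure set T -> \bar R},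
  forall B, M B = \int[m]_w (Y w * k w B).
Proof.
pose M B := \int[m]_w (Y w * k w B).
have M0 : M set0 = 0.
  by rewrite /M integral0_eq// => w _; rewrite measure0 mule0.
have M_ge0 B : 0 <= M B by apply: integral_ge0 => w _; rewrite mule_ge0.
have Msa : semi_sigma_additive M.
  move=> U mU tU mUU; rewrite [X in _ --> X](_ : _ =
    \int[m]_w (\sum_(n <oo) (Y w * k w (U n)))); last first.
    apply: eq_integral => w _.
    have -> : k w (\bigcup_n U n) = limn (fun n => \sum_(0 <= i < n) k w (U i)).
      by apply/esym/cvg_lim => //; exact/measure_semi_sigma_additive.
    rewrite -limeMl_ge0//.
    - by apply/congr_lim/funext => n/=; rewrite ge0_sume_distrr.
    - by move=> n; apply: sume_ge0.
    - by apply: ereal_nondecreasing_series => n _.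
  apply/cvg_closeP; split.
    by apply: is_cvg_nneseries => n _ _; exact: M_ge0.
  rewrite closeE// integral_nneseries//.
  - by move=> n; exact: mYk.
  - by move=> n w _; rewrite mule_ge0.
pose mM := isMeasure.Build _ _ _ M M0 M_ge0 Msa.
by exists (HB.pack_for {measure set T -> \bar R} M mM).
Qed.

Variable M : {measure set T -> \bar R}.
Hypothesis ME : forall B, measurable B -> M B = \int[m]_w (Y w * k w B).

Import HBNNSimple.

Let integral_mixture_nnsfun (f : {nnsfun T >-> R}) :
  \int[M]_x (f x)%:E = \int[m]_w (Y w * \int[k w]_x (f x)%:E).
Proof.
rewrite integralT_nnsfun sintegralE.
under [RHS]eq_integral.
  move=> w _; rewrite integralT_nnsfun sintegralE ge0_mule_fsumr; last first.
    by move=> x; exact: nnsfun_mulemu_ge0.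
  over.
rewrite ge0_integral_fsum//; last 2 first.
- move=> r; under eq_fun do rewrite muleCA.
  by apply: measurable_funeM; exact: mYk.
- by move=> r w _; rewrite mule_ge0// nnsfun_mulemu_ge0.
apply: eq_fsbigr => r _; rewrite ME//.
have [r0|r0] := leP 0%R r.
  rewrite -ge0_integralZl//; last 2 first.
  - exact: mYk.
  - by move=> w _; rewrite mule_ge0.
  by apply: eq_integral => w _; rewrite muleCA.
rewrite !integral0_eq ?mule0// => w _.
- by rewrite preimage_nnfun0// measure0 !mule0.
- by rewrite preimage_nnfun0// measure0 mule0.
Qed.

Lemma integral_mixture (f : T -> \bar R) : (forall x, 0 <= f x) ->
  measurable_fun setT f -> \int[M]_x f x = \int[m]_w (Y w * \int[k w]_x f x).
Proof.
move=> f0 mf.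
pose f_ := nnsfun_approx measurableT mf.
have mc (mu : {measure set T -> \bar R}) :
    \int[mu]_x f x = limn (fun n => \int[mu]_x (f_ n x)%:E).
  rewrite -monotone_convergence//.
  - apply/eq_integral => z _; apply/esym/cvg_lim => //=.
    exact: cvg_nnsfun_approx.
  - by move=> n; exact/measurable_EFinP.
  - by move=> n z _; rewrite lee_fin.
  - by move=> z _ a b ab; rewrite lee_fin; exact/lefP/nd_nnsfun_approx.
have nd (mu : {measure set T -> \bar R}) :
    {homo (fun n => \int[mu]_x (f_ n x)%:E) : a b / (a <= b)%N >-> a <= b}.
  move=> a b ab; apply: ge0_le_integral => //.
  - by move=> z _; rewrite lee_fin.
  - exact/measurable_EFinP.
  - exact/measurable_EFinP.
  - by move=> z _; rewrite lee_fin; exact/lefP/nd_nnsfun_approx.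
rewrite mc; under eq_fun do rewrite integral_mixture_nnsfun.
rewrite -monotone_convergence//.
- apply: eq_integral => w _; rewrite mc limeMl_ge0//.
  - by move=> n; apply: integral_ge0 => x _; rewrite lee_fin.
- move=> n; apply: measurable_fun_mixture; first by move=> x; rewrite lee_fin.
  exact/measurable_EFinP.
- by move=> n w _; rewrite mule_ge0// integral_ge0// => x _; rewrite lee_fin.
- by move=> w _ a b ab; rewrite lee_wpmul2l// nd.
Qed.
End mixture.


(** * The Markov property for functions of the past *)

Lemma integral_indic_mul d (T : measurableType d) (R : realType)
    (m : {measure set T -> \bar R}) (A : set T) (f : T -> \bar R) :
  (\int[m]_x ((\1_A x)%:E * f x) = \int[m]_(x in A) f x)%E.
Proof.
rewrite [RHS]integral_mkcond; apply: eq_integral => x _.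
by rewrite patchE indicE; case: ifPn => _; rewrite ?mul1e ?mul0e.
Qed.

Section process.
Context d (E : measurableType d) dW (W : measurableType dW) (R : realType).
Variables (P : R.-pker E ~> W) (X : R -> W -> E).
Hypothesis mp : markov_process P X.
Local Open Scope ereal_scope.

Definition transition (t : R) (f : E -> \bar R) (x : E) : \bar R :=
  \int[P x]_w f (X t w).

Lemma measurable_time (t : R) : (0 <= t)%R -> measurable_fun setT (X t).
Proof.
move=> t0; have := mp_measurable mp.
set D := (X in measurable_fun X _) => mX.
have mD : measurable D.
  apply: measurableX => //; rewrite (_ : [set t | _] = `[0%R, +oo[%classic)//.
  by apply/seteqP; split => r/=; rewrite in_itv/= andbT.
have := @measurable_comp _ _ _ _ _ _ D _ setT (fun w => (t, w)) mD _ mX.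
apply; first by move=> _ [w _ <-].
exact: measurable_fun_pair.
Qed.

Lemma measurable_dirac_time (t : R) B : (0 <= t)%R -> measurable B ->
  measurable_fun setT (fun w => \d_(X t w) B : \bar R).
Proof.
move=> t0 mB; apply/measurable_EFinP.
have mX := measurable_time t0 measurableT mB; rewrite setTI in mX.
exact: measurable_indic.
Qed.

Lemma ex_transition_kernel (t : R) : (0 <= t)%R ->
  exists k : E -> {measure set E -> \bar R},
    [/\ forall x B, k x B = P x (X t @^-1` B),
        forall B, measurable B -> measurable_fun setT (k^~ B) &
        forall x f, (forall y, 0 <= f y) -> measurable_fun setT f ->
          \int[k x]_y f y = transition t f x].
Proof.
move=> t0; have mX := measurable_time t0.
exists (fun x => pushforward (P x) (X t)); split=> //.
- move=> B mB; apply: measurable_kernel.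
  by have := mX measurableT B mB; rewrite setTI.
- by move=> x g g0 mg; rewrite (ge0_integral_pushforward mX)// => y _; exact: g0.
Unshelve. by [].
Qed.

Section fixed_time.
Variable t : R.
Hypothesis t0 : (0 <= t)%R.

Lemma transition_ge0 f x : (forall y, 0 <= f y) -> 0 <= transition t f x.
Proof. by move=> f0; apply: integral_ge0. Qed.

Lemma measurable_transition f : (forall y, 0 <= f y) ->
  measurable_fun setT f -> measurable_fun setT (transition t f).
Proof.
move=> f0 mf; have [k [_ mk kE]] := ex_transition_kernel t0.
rewrite (_ : transition t f = fun x => \int[k x]_y f y); last first.
  by apply/funext => x; rewrite kE.
exact: measurable_fun_integral_kernel.
Qed.

Lemma le_transition f g x : (forall y, 0 <= f y) -> measurable_fun setT f ->
  measurable_fun setT g -> (forall y, f y <= g y) ->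
  transition t f x <= transition t g x.
Proof.
move=> f0 mf mg fg; have mX := measurable_time t0.
apply: ge0_le_integral => //.
- exact: measurableT_comp mf mX.
- exact: measurableT_comp mg mX.
Qed.

Lemma transition_cst (c : R) x : transition t (cst c%:E) x = c%:E.
Proof. by rewrite /transition integral_cst// prob_kernel mule1. Qed.

End fixed_time.

Lemma transition0 f x : (forall y, 0 <= f y) -> measurable_fun setT f ->
  transition 0 f x = f x.
Proof.
move=> f0 mf; have [k [kB _ kE]] := ex_transition_kernel (lexx 0%R).
rewrite -kE//.
rewrite (@eq_measure_integral _ _ _ _ (\d_x)); last first.
  by move=> B mB _; rewrite /= kB (mp_start mp).
by rewrite integral_dirac// diracT mul1e.
Qed.

Lemma sub_past_measurable (s : R) A : past X s A -> measurable A.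
Proof.
apply: smallest_sub; first exact: sigma_algebra_measurable.
move=> _ [u /= us [B mB <-]]; apply: measurable_time => //.
by move: us; rewrite in_itv/= => /andP[].
Qed.

Lemma pastI (s : R) A B : past X s A -> past X s B -> past X s (A `&` B).
Proof.
move=> pA pB.
exact: (@measurableI _ (g_sigma_algebraType (\bigcup_(u in `[0%R, s])
  preimage_set_system setT (X u) measurable)) A B pA pB).
Qed.

Lemma past_time (s u : R) B : (0 <= u)%R -> (u <= s)%R -> measurable B ->
  past X s (X u @^-1` B).
Proof.
move=> u0 us mB; apply: sub_sigma_algebra; exists u.
  by rewrite /= in_itv/= u0.
by exists B => //; rewrite setTI.
Qed.

(** The Markov property at time [s] with an extra weight [Y]. Localizing on all
    the events of the past makes the property stable under multiplication by a
    function of an earlier position, see [markov_weight_mul]; so products along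
    a grid are reached without a theory of functions measurable with respect to
    the past. *)
Definition markov_weight (s : R) (x : E) (Y : W -> \bar R) :=
  forall A, past X s A -> forall t f, (0 <= t)%R -> (forall y, 0 <= f y) ->
    measurable_fun setT f ->
    \int[P x]_w ((\1_A w)%:E * Y w * f (X (s + t) w)) =
    \int[P x]_w ((\1_A w)%:E * Y w * transition t f (X s w)).

Lemma markov_weight1 s x : (0 <= s)%R -> markov_weight s x (cst 1).
Proof.
move=> s0 A pA t f t0 f0 mf; have mA := sub_past_measurable pA.
have st0 : (0 <= s + t)%R by rewrite addr_ge0.
have m1 : measurable_fun setT (fun w => (\1_A w)%:E : \bar R).
  exact/measurable_EFinP.
have Y0 w : 0 <= (\1_A w)%:E :> \bar R by rewrite lee_fin.
have mX := measurable_time st0; have mXs := measurable_time s0.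
have mk1 B : measurable B -> measurable_fun setT (fun w => \d_(X (s + t) w) B : \bar R).
  by move=> mB; exact: measurable_dirac_time.
have [k2 [k2B mk2 k2E]] := ex_transition_kernel t0.
have [M ME] := ex_mixture (P x) Y0 m1 mk1.
under eq_integral do rewrite mule1.
under [RHS]eq_integral do rewrite mule1.
transitivity (\int[M]_y f y).
  rewrite (integral_mixture Y0 m1 mk1 (fun B _ => ME B) f0 mf).
  by apply: eq_integral => w _; rewrite integral_dirac// diracT mul1e.
rewrite (@integral_mixture _ _ _ _ _ (P x) _ (fun w => k2 (X s w)) Y0 m1) => [||B mB|//|//].
- by apply: eq_integral => w _; rewrite k2E.
- move=> B mB; exact: measurableT_comp (mk2 B mB) mXs.
rewrite ME.
rewrite [RHS]integral_indic_mul.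
transitivity (P x (A `&` X (s + t) @^-1` B)).
  have mXB := mX measurableT B mB; rewrite setTI in mXB.
  rewrite -(setIT (_ `&` _)) -integral_indic//; last exact: measurableI.
  apply: eq_integral => w _; by rewrite indicI EFinM.
rewrite (mp_markov mp)//; apply: eq_integral => w _; exact/esym/k2B.
Qed.

(** When the new factor is the indicator of a set, it is absorbed into the event
    [A]; the general case is a mixture. *)
Lemma markov_weight_mul s u x Y (g : E -> \bar R) :
  (0 <= u)%R -> (u <= s)%R -> (forall w, 0 <= Y w) -> measurable_fun setT Y ->
  (forall y, 0 <= g y) -> measurable_fun setT g ->
  markov_weight s x Y -> markov_weight s x (fun w => Y w * g (X u w)).
Proof.
move=> u0 us Y0 mY g0 mg YW A pA t f t0 f0 mf.
have mA := sub_past_measurable pA.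
have s0 : (0 <= s)%R by rewrite (le_trans u0).
have st0 : (0 <= s + t)%R by rewrite addr_ge0.
have m1 : measurable_fun setT (fun w => (\1_A w)%:E : \bar R).
  exact/measurable_EFinP.
have A0 w : 0 <= (\1_A w)%:E :> \bar R by rewrite lee_fin.
have mf1 : measurable_fun setT (fun w => f (X (s + t) w)).
  exact: measurableT_comp mf (measurable_time st0).
have mf2 : measurable_fun setT (fun w => transition t f (X s w)).
  exact: measurableT_comp (measurable_transition t0 f0 mf) (measurable_time s0).
have mk B : measurable B -> measurable_fun setT (fun w => \d_(X u w) B : \bar R).
  by move=> mB; exact: measurable_dirac_time.
have Z10 w : 0 <= (\1_A w)%:E * Y w * f (X (s + t) w) by rewrite !mule_ge0.
have Z20 w : 0 <= (\1_A w)%:E * Y w * transition t f (X s w).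
  by rewrite !mule_ge0// transition_ge0.
have mZ1 : measurable_fun setT (fun w => (\1_A w)%:E * Y w * f (X (s + t) w)).
  by apply: emeasurable_funM => //; exact: emeasurable_funM.
have mZ2 : measurable_fun setT
    (fun w => (\1_A w)%:E * Y w * transition t f (X s w)).
  by apply: emeasurable_funM => //; exact: emeasurable_funM.
have [M ME] := ex_mixture (P x) Z10 mZ1 mk.
have gE w : g (X u w) = \int[\d_(X u w)]_y g y.
  by rewrite integral_dirac// diracT mul1e.
transitivity (\int[M]_y g y).
  rewrite (integral_mixture Z10 mZ1 mk (fun B _ => ME B) g0 mg).
  by apply: eq_integral => w _; rewrite -gE muleA -!muleA; congr (_ * (_ * _));
    rewrite muleC.
rewrite (integral_mixture (m := P x) Z20 mZ2 mk _ g0 mg).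
  by apply: eq_integral => w _; rewrite -gE -!muleA; congr (_ * (_ * _));
    rewrite muleC.
move=> B mB; rewrite ME.
have pAB : past X s (A `&` X u @^-1` B) by apply: pastI => //; exact: past_time.
have E1 w : (\1_(A `&` X u @^-1` B) w)%:E = (\1_A w)%:E * \d_(X u w) B :> \bar R.
  by rewrite indicI EFinM.
transitivity (\int[P x]_w
   ((\1_(A `&` X u @^-1` B) w)%:E * Y w * f (X (s + t) w))).
  by apply: eq_integral => w _; rewrite E1 muleAC; congr (_ * _); exact: muleAC.
rewrite (YW _ pAB)//.
by apply: eq_integral => w _; rewrite E1 [RHS]muleAC; congr (_ * _); exact: muleAC.
Qed.

Section product.
Variables (th h : R) (G : E -> \bar R).
Hypotheses (th0 : (0 <= th)%R) (h0 : (0 <= h)%R).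
Hypotheses (G0 : forall y, 0 <= G y) (mG : measurable_fun setT G).

Definition grid (n : nat) : R := n%:R * h + th.

Definition grid_prod (n : nat) (w : W) : \bar R :=
  \prod_(k < n) G (X (grid k) w).

(** One step of the splitting scheme for the Feynman-Kac semigroup: first the
    transition over [h], then the multiplication by the weight. *)
Definition split_step (f : E -> \bar R) : E -> \bar R :=
  fun y => G y * transition h f y.

Lemma grid_ge0 n : (0 <= grid n)%R.
Proof. by rewrite addr_ge0// mulr_ge0. Qed.

Lemma grid_prod_ge0 n w : 0 <= grid_prod n w.
Proof. by apply: prode_ge0. Qed.

Lemma grid_prodS n w : grid_prod n.+1 w = grid_prod n w * G (X (grid n) w).
Proof. by rewrite /grid_prod big_ord_recr. Qed.

Lemma measurable_grid_prod n : measurable_fun setT (grid_prod n).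
Proof.
elim: n => [|n IH].
  by rewrite (_ : grid_prod 0 = cst 1)//; apply/funext => w; rewrite /grid_prod big_ord0.
rewrite (_ : grid_prod n.+1 = fun w => grid_prod n w * G (X (grid n) w)).
  apply: emeasurable_funM => //.
  exact: measurableT_comp mG (measurable_time (grid_ge0 n)).
by apply/funext => w; rewrite grid_prodS.
Qed.

Lemma grid_prod_weight n m x : (m <= n.+1)%N ->
  markov_weight (grid n) x (grid_prod m).
Proof.
elim: m => [_|m IH mn].
  rewrite (_ : grid_prod 0 = cst 1); first exact: markov_weight1 (grid_ge0 n).
  by apply/funext => w; rewrite /grid_prod big_ord0.
rewrite (_ : grid_prod m.+1 = fun w => grid_prod m w * G (X (grid m) w)); last first.
  by apply/funext => w; rewrite grid_prodS.
apply: markov_weight_mul => //.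
- exact: grid_ge0.
- by rewrite lerD2r ler_wpM2r// ler_nat.
- by move=> w; exact: grid_prod_ge0.
- exact: measurable_grid_prod.
- by apply: IH; exact: ltnW.
Qed.

Lemma split_step_ge0 f : (forall y, 0 <= f y) -> forall y, 0 <= split_step f y.
Proof. by move=> f0 y; rewrite mule_ge0// transition_ge0. Qed.

Lemma measurable_split_step f : (forall y, 0 <= f y) -> measurable_fun setT f ->
  measurable_fun setT (split_step f).
Proof.
by move=> f0 mf; apply: emeasurable_funM => //; exact: measurable_transition.
Qed.

(** The discrete Feynman-Kac formula: the Markov property at the last time of
    the grid turns the last factor into a [split_step] applied to [f]. *)
Lemma integral_grid_prod n x f : (forall y, 0 <= f y) -> measurable_fun setT f ->
  \int[P x]_w (grid_prod n w * f (X (grid n) w)) =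
  transition th (iter n split_step f) x.
Proof.
elim: n f => [|n IH] f f0 mf.
  apply: eq_integral => w _.
  by rewrite /grid_prod big_ord0 mul1e /grid mul0r add0r.
rewrite iterSr -IH; last 2 first.
- exact: split_step_ge0.
- exact: measurable_split_step.
have pT : past X (grid n) setT.
  by rewrite -(preimage_setT (X (grid n))); apply: past_time => //; exact: grid_ge0.
have := @grid_prod_weight n n.+1 x (leqnn _) setT pT h f h0 f0 mf.
under eq_integral do rewrite indicT mul1e.
under [X in _ = X -> _]eq_integral do rewrite indicT mul1e.
rewrite (_ : grid n + h = grid n.+1)%R; last first.
  by rewrite /grid -natr1 mulrDl mul1r addrAC.
move=> ->; apply: eq_integral => w _.
by rewrite grid_prodS /split_step muleA.
Qed.

End product.

End process.

(** The instances make Tonelli's theorem applicable to the law of the process. *)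
Section law_probability.
Context d (E : measurableType d) dW (W : measurableType dW) (R : realType).
Variables (P : R.-pker E ~> W) (nu : probability E R).
Local Open Scope ereal_scope.

Let law_mixture : exists M : {measure set W -> \bar R}, law P nu = M.
Proof.
have c0 (y : E) : 0 <= cst (1 : \bar R) y by [].
have mc : measurable_fun setT (cst 1 : E -> \bar R) by [].
have mP B : measurable B -> measurable_fun setT (P^~ B) by exact: measurable_kernel.
have [M ME] := ex_mixture nu c0 mc mP.
exists M; apply/funext => A; rewrite ME.
by apply: eq_integral => x _; rewrite mul1e.
Qed.

Let law0 : law P nu set0 = 0.
Proof. by have [M ->] := law_mixture; rewrite measure0. Qed.

Let law_ge0 A : 0 <= law P nu A.
Proof. by apply: integral_ge0. Qed.

Let law_sigma_additive : semi_sigma_additive (law P nu).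
Proof. by have [M ->] := law_mixture; exact: measure_semi_sigma_additive. Qed.

HB.instance Definition _ := isMeasure.Build _ _ _ (law P nu)
  law0 law_ge0 law_sigma_additive.

Let law_setT : law P nu setT = 1.
Proof.
rewrite /law; under eq_integral do rewrite prob_kernel.
by rewrite integral_cst// mul1e; exact: probability_setT.
Qed.

HB.instance Definition _ := Measure_isProbability.Build _ _ _ (law P nu) law_setT.

Lemma integral_law f : (forall w, 0 <= f w) -> measurable_fun setT f ->
  \int[law P nu]_w f w = \int[nu]_x \int[P x]_w f w.
Proof.
move=> f0 mf.
have c0 (y : E) : 0 <= cst (1 : \bar R) y by [].
have mc : measurable_fun setT (cst 1 : E -> \bar R) by [].
have mP B : measurable B -> measurable_fun setT (P^~ B) by exact: measurable_kernel.
rewrite (integral_mixture (m := nu) c0 mc mP _ f0 mf).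
  by apply: eq_integral => x _; rewrite mul1e.
by move=> B mB; apply: eq_integral => x _; rewrite mul1e.
Qed.

End law_probability.

(** * The space of square-integrable functions *)

Section square_integrable.
Context d (E : measurableType d) (R : realType) (mu : probability E R).
Implicit Types f g h : L2 mu.

Lemma Lnorm2_sqr (f : E -> R) :
  ('N[mu]_2%:E[EFin \o f] `^ 2 = \int[mu]_x (f x ^+ 2)%:E)%E.
Proof.
rewrite poweR_Lnorm//; apply: eq_integral => x _ /=.
by rewrite powR_mulrn// real_normK ?num_real.
Qed.

Lemma ex_L2 (f : E -> R) : measurable_fun setT f ->
  (\int[mu]_x (f x ^+ 2)%:E < +oo)%E -> exists g : L2 mu, g = f :> (E -> R).
Proof.
move=> mf f2; suff fP : f \in Lfun mu 2%:E by exists (Lfun_Sub (@lee1n R 2) fP).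
rewrite inE; apply/andP; split; rewrite inE//=.
by apply: (@lty_poweRy _ _ 2) => //; rewrite Lnorm2_sqr.
Qed.

Lemma integrable_mulL2 f g :
  mu.-integrable setT (EFin \o (fun x => f x * g x)).
Proof. by apply/Lfun1_integrable; exact: Lfun2_mul_Lfun1 (LfunP f) (LfunP g). Qed.

Lemma integrable_L2 f : mu.-integrable setT (EFin \o f).
Proof.
apply/Lfun1_integrable/Lfun_subset12; last exact: LfunP.
exact: fin_num_measure.
Qed.

Lemma measurable_L2 f : measurable_fun setT f.
Proof. exact: measurable_funP. Qed.

Lemma sf_dot : symmetric_bilinear (fun f g => dot mu f g).
Proof.
split=> [f g|f g h|a f h]; rewrite /dot.
- by apply: eq_Rintegral => x _; rewrite mulrC.
- rewrite -RintegralD//; [|exact: integrable_mulL2|exact: integrable_mulL2].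
  by apply: eq_Rintegral => x _; rewrite -mulrDl.
- rewrite -RintegralZl//; last exact: integrable_mulL2.
  by apply: eq_Rintegral => x _; rewrite mulrA.
Qed.

Lemma dot_ge0 f : 0 <= dot mu f f.
Proof. by apply: Rintegral_ge0 => x _; rewrite -expr2 sqr_ge0. Qed.

Lemma dot_ae_eq f g h : f = g %[ae mu] -> dot mu f h = dot mu g h.
Proof.
move=> fg; congr fine; apply: ae_eq_integral => //.
- by have /integrableP[] := integrable_mulL2 f h.
- by have /integrableP[] := integrable_mulL2 g h.
- by apply: filterS fg => x fgx _; rewrite fgx.
Qed.

Lemma ind_ae_eq f g : f = g %[ae mu] ->
  indistinguishable (fun f g => dot mu f g) f g.
Proof.
by move=> fg; apply/(indP sf_dot dot_ge0) => h; exact: dot_ae_eq.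
Qed.

Lemma dotE f g : ((dot mu f g)%:E = \int[mu]_x (f x * g x)%:E)%E.
Proof. by rewrite fineK// integrable_fin_num//; exact: integrable_mulL2. Qed.

Lemma norm2E f : norm2 mu f = seminorm (fun f g => dot mu f g) f.
Proof.
have n0 : 0 <= norm2 mu f by rewrite fine_ge0// Lnorm_ge0.
rewrite /seminorm -(ger0_norm n0) -sqrtr_sqr; congr Num.sqrt.
apply: EFin_inj; rewrite dotE.
transitivity ('N[mu]_2%:E[EFin \o f] `^ 2)%E; last by rewrite Lnorm2_sqr.
by rewrite -finite_norm_fine poweR_EFin powR_mulrn.
Qed.

Lemma Lnorm2E f : ('N[mu]_2%:E[EFin \o f] =
  (seminorm (fun f g => dot mu f g) f)%:E)%E.
Proof. by rewrite -norm2E finite_norm_fine. Qed.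

Lemma ex_L2_cst (c : R) : exists g : L2 mu, g = cst c :> (E -> R).
Proof.
apply: ex_L2 => //.
rewrite -[ltLHS]/(\int[mu]_x (cst (c ^+ 2)%:E x))%E integral_cst//.
by rewrite [X in (_ * X)%E](_ : _ = 1%E) ?mule1 ?ltry//; exact: probability_setT.
Qed.

Lemma mean_cst (c : R) : mean mu (cst c) = c.
Proof. by rewrite /mean Rintegral_cst// [X in fine X](_ : _ = 1%E) ?mulr1//; exact: probability_setT. Qed.

End square_integrable.

(** * The semigroup on square-integrable functions *)

(** Jensen's inequality for the square, from the tangent line at the mean. If
    the right-hand side is finite then [g] is integrable; otherwise there is
    nothing to prove, whatever value the integral of [g] is given. *)
Lemma sqr_Rintegral_le d (W : measurableType d) (R : realType)
    (p : {measure set W -> \bar R}) (g : W -> R) :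
  p setT = 1%E -> measurable_fun setT g ->
  (((\int[p]_w g w) ^+ 2)%:E <= \int[p]_w (g w ^+ 2)%:E)%E.
Proof.
move=> p1 mg; set c := Rintegral _ _ _.
have [goo|goo] := leP +oo%E (\int[p]_w (g w ^+ 2)%:E)%E.
  by rewrite (le_trans _ goo)// leey.
have pfin : p setT \is a fin_num by rewrite p1.
have g2 : p.-integrable setT (EFin \o (fun w => g w ^+ 2)).
  apply/integrableP; split; first exact/measurable_EFinP/measurable_funX.
  under eq_integral do rewrite gee0_abs ?lee_fin ?sqr_ge0//.
  exact: goo.
have icst (r : R) : p.-integrable setT (EFin \o cst r).
  apply/integrableP; split; first exact/measurable_EFinP.
  rewrite -[ltLHS]/(\int[p]_x (cst `|r|%:E x))%E.
  by rewrite integral_cst// p1 mule1 ltry.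
have g1 : p.-integrable setT (EFin \o g).
  have i12 : p.-integrable setT (EFin \o (fun w => 1 + g w ^+ 2)).
    exact: (integrableD measurableT (icst 1) g2).
  apply: le_integrable i12 => //; first exact/measurable_EFinP.
  move=> w _ /=; rewrite lee_fin [leRHS]ger0_norm ?addr_ge0 ?sqr_ge0//.
  rewrite -[g w ^+ 2]real_normK ?num_real//.
  have := sqr_ge0 (`|g w| - 2^-1); lra.
have -> : (\int[p]_w (g w ^+ 2)%:E = (\int[p]_w (g w ^+ 2))%:E)%E.
  by rewrite fineK// integrable_fin_num.
rewrite lee_fin.
have ig : p.-integrable setT (EFin \o (fun w => 2 * c * g w)).
  exact: (integrableZl measurableT (2 * c) g1).
have -> : c ^+ 2 = \int[p]_w (2 * c * g w - c ^+ 2).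
  rewrite (RintegralB measurableT ig (icst (c ^+ 2))) RintegralZl//.
  rewrite Rintegral_cst// p1 -/c [fine _]/=; ring.
apply: le_Rintegral => //.
  exact: (integrableB measurableT ig (icst _)).
by move=> w _; have := sqr_ge0 (g w - c); lra.
Qed.

Section semigroup.
Context d (E : measurableType d) dW (W : measurableType dW) (R : realType).
Variables (P : R.-pker E ~> W) (X : R -> W -> E) (mu : probability E R).
Hypothesis mp : markov_process P X.
Hypothesis inv : invariant_probability P X mu.
Local Notation Q := (transition P X).
Local Notation sg := (semigroup P X).

Lemma integral_transition t f : 0 <= t -> (forall y, 0 <= f y)%E ->
  measurable_fun setT f -> (\int[mu]_x Q t f x = \int[mu]_x f x)%E.
Proof.
move=> t0 f0 mf; have [k [kB mk kE]] := ex_transition_kernel mp t0.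
have c0 (y : E) : (0 <= cst (1 : \bar R) y)%E by [].
have mc : measurable_fun setT (cst 1%E : E -> \bar R) by [].
rewrite [RHS](integral_mixture (m := mu) c0 mc mk _ f0 mf).
  by apply: eq_integral => x _; rewrite mul1e kE.
move=> B mB; apply: etrans (esym (inv t0 mB)) _; apply: eq_integral => x _.
by rewrite mul1e kB.
Qed.

Lemma chapman_kolmogorov s t f x : 0 <= s -> 0 <= t ->
  (forall y, 0 <= f y)%E -> measurable_fun setT f ->
  Q (s + t) f x = Q s (Q t f) x.
Proof.
move=> s0 t0 f0 mf.
have pT : past X s setT.
  by rewrite -(preimage_setT (X s)); exact: past_time.
have := markov_weight1 mp x s0 pT t0 f0 mf.
under eq_integral do rewrite indicT !mul1e.
under [X in _ = X -> _]eq_integral do rewrite indicT !mul1e.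
exact: id.
Qed.

Lemma transition_posneg t f x : Q t f x = (Q t f^\+ x - Q t f^\- x)%E.
Proof.
by rewrite /transition integralE; congr (_ - _)%E; apply: eq_integral => w _;
  rewrite ?funeposE ?funenegE.
Qed.

Lemma measurable_semigroup t f : 0 <= t -> measurable_fun setT f ->
  measurable_fun setT (sg t f).
Proof.
move=> t0 mf; rewrite (_ : sg t f = fine \o Q t (EFin \o f))//.
apply: (measurableT_comp (fine_measurable measurableT)).
have mf' : measurable_fun setT (EFin \o f) by exact/measurable_EFinP.
rewrite (_ : Q t _ = (Q t (EFin \o f)^\+ \- Q t (EFin \o f)^\-)%E); last first.
  by apply/funext => x; rewrite transition_posneg.
apply: emeasurable_funB; apply: measurable_transition => //.
- exact: measurable_funepos.
- exact: measurable_funeneg.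
Qed.

Lemma sqr_semigroup_le t f x : 0 <= t -> measurable_fun setT f ->
  ((sg t f x ^+ 2)%:E <= Q t (fun y => (f y ^+ 2)%:E) x)%E.
Proof.
move=> t0 mf; apply: sqr_Rintegral_le; first exact: prob_kernel.
exact: measurableT_comp mf (measurable_time mp t0).
Qed.

(** By invariance, a [mu]-null set is almost surely avoided at time [t], for
    [mu]-almost every starting point. *)
Lemma ae_time t (Phi : E -> Prop) : 0 <= t -> {ae mu, forall y, Phi y} ->
  {ae mu, forall x, {ae P x, forall w, Phi (X t w)}}.
Proof.
move=> t0 [N [mN N0 sN]].
have mXN : measurable (X t @^-1` N).
  by have := measurable_time mp t0 measurableT mN; rewrite setTI.
have mPN : measurable_fun setT (P^~ (X t @^-1` N)) by exact: measurable_kernel.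
have : ae_eq mu setT (P^~ (X t @^-1` N)) (cst 0%E).
  apply/ae_eq_integral_abs => //.
  apply: etrans N0; apply: etrans (inv t0 mN).
  by apply: eq_integral => x _; rewrite gee0_abs.
apply: filterS => x /(_ I) Px0; exists (X t @^-1` N); split => //.
by move=> w /= nPhi; apply: sN.
Qed.

Lemma ae_transition_fin t f : 0 <= t -> (forall y, 0 <= f y)%E ->
  mu.-integrable setT f -> {ae mu, forall x, Q t f x \is a fin_num}.
Proof.
move=> t0 f0 fi; have /integrableP[mf foo] := fi.
have Qi : mu.-integrable setT (Q t f).
  apply/integrableP; split; first exact: measurable_transition.
  under eq_integral do rewrite gee0_abs ?transition_ge0//.
  rewrite integral_transition//.
  by under eq_integral do rewrite -(gee0_abs (f0 _)).
by have := integrable_ae measurableT Qi; apply: filterS => x /(_ I).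
Qed.

Lemma ae_integrable_time t f : 0 <= t -> mu.-integrable setT (EFin \o f) ->
  {ae mu, forall x, (P x).-integrable setT (fun w => (f (X t w))%:E)}.
Proof.
move=> t0 fi; have /integrableP[/measurable_EFinP mf _] := fi.
have f0 y : (0 <= (abse \o (EFin \o f)) y)%E by rewrite /= lee_fin.
have := ae_transition_fin t0 f0 (integrable_abse fi).
apply: filterS => x; rewrite ge0_fin_numE ?transition_ge0// => Qoo.
apply/integrableP; split => //; apply/measurable_EFinP.
exact: measurableT_comp mf (measurable_time mp t0).
Qed.

Lemma ae_semigroup_linear t (a : R) f g : 0 <= t ->
  mu.-integrable setT (EFin \o f) -> mu.-integrable setT (EFin \o g) ->
  {ae mu, forall x, sg t (fun y => a * f y + g y) x = a * sg t f x + sg t g x}.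
Proof.
move=> t0 /(ae_integrable_time t0) fi /(ae_integrable_time t0) gi.
apply: filterS2 fi gi => x fx gx.
have afx : (P x).-integrable setT (EFin \o (fun w => a * f (X t w))).
  exact: (integrableZl measurableT a fx).
by rewrite /semigroup RintegralD// RintegralZl.
Qed.

(** The Chapman-Kolmogorov identity holds for the positive and negative parts
    of [f], whose images are finite almost everywhere. *)
Lemma semigroupD s t f : 0 <= s -> 0 <= t -> mu.-integrable setT (EFin \o f) ->
  sg (s + t) f = sg s (sg t f) %[ae mu].
Proof.
move=> s0 t0 fi; have st0 := addr_ge0 s0 t0.
have /integrableP[mf' _] := fi; have /measurable_EFinP mf := mf'.
set fp := (EFin \o f)^\+%E; set fn := (EFin \o f)^\-%E.
have fp0 y : (0 <= fp y)%E by exact: funepos_ge0.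
have fn0 y : (0 <= fn y)%E by exact: funeneg_ge0.
have ip : mu.-integrable setT fp by exact: integrable_funepos.
have in_ : mu.-integrable setT fn by exact: integrable_funeneg.
have mfp : measurable_fun setT fp by exact: measurable_funepos.
have mfn : measurable_fun setT fn by exact: measurable_funeneg.
have fE : {ae mu, forall y, (sg t f y)%:E = (Q t fp y - Q t fn y)%E}.
  apply: filterS2 (ae_transition_fin t0 fp0 ip) (ae_transition_fin t0 fn0 in_).
  move=> y py ny; rewrite -[X in X%:E]/(fine (Q t (EFin \o f) y)).
  by rewrite transition_posneg fineK// fin_numB py.
have := ae_time s0 fE.
apply: filterS3 (ae_transition_fin st0 fp0 ip) (ae_transition_fin st0 fn0 in_).
move=> x; rewrite !chapman_kolmogorov// => px nx fx _.
rewrite -[LHS]/(fine (Q (s + t) (EFin \o f) x)) transition_posneg.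
rewrite -/fp -/fn !chapman_kolmogorov//; congr fine.
have mX := measurable_time mp s0.
have mQp : measurable_fun setT (fun w => Q t fp (X s w)).
  exact: measurableT_comp (measurable_transition mp t0 fp0 mfp) mX.
have mQn : measurable_fun setT (fun w => Q t fn (X s w)).
  exact: measurableT_comp (measurable_transition mp t0 fn0 mfn) mX.
have iQ g : (forall y, 0 <= g y)%E -> measurable_fun setT (fun w => Q t g (X s w)) ->
    Q s (Q t g) x \is a fin_num ->
    (P x).-integrable setT (fun w => Q t g (X s w)).
  move=> g0 mg; rewrite ge0_fin_numE; last first.
    by apply: integral_ge0 => w _; exact: transition_ge0.
  move=> goo; apply/integrableP; split => //.
  by under eq_integral do rewrite gee0_abs ?transition_ge0//.
rewrite -[LHS]/(\int[P x]_w Q t fp (X s w) - \int[P x]_w Q t fn (X s w))%E.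
rewrite -integralB//; [|exact: iQ|exact: iQ].
apply: ae_eq_integral => //.
- exact: emeasurable_funB.
- apply/measurable_EFinP; apply: measurableT_comp mX.
  exact: measurable_semigroup.
- by apply: filterS fx => w -> _.
Qed.

Lemma ex_semigroup_L2 : exists T : R -> L2 mu -> L2 mu,
  forall t f, 0 <= t -> T t f = sg t f :> (E -> R).
Proof.
suff /choice[T TE] : forall tf : R * L2 mu, exists g : L2 mu,
    0 <= tf.1 -> g = sg tf.1 tf.2 :> (E -> R).
  by exists (fun t f => T (t, f)) => t f t0; exact: (TE (t, f)).
move=> [t f] /=; have [t0|_] := leP 0 t; last by exists 0.
have mf : measurable_fun setT f := measurable_L2 f.
have [||g gE] := @ex_L2 _ _ _ mu (sg t f); last by exists g.
- exact: measurable_semigroup.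
- rewrite (@le_lt_trans _ _ (\int[mu]_x Q t (fun y => (f y ^+ 2)%:E) x)%E)//.
    apply: ge0_le_integral => //.
    + by move=> x _; rewrite lee_fin sqr_ge0.
    + exact/measurable_EFinP/measurable_funX/measurable_semigroup.
    + apply: measurable_transition => //.
        by move=> y; rewrite lee_fin sqr_ge0.
      exact/measurable_EFinP/measurable_funX.
    + by move=> x _; exact: sqr_semigroup_le.
  rewrite integral_transition//; last 2 first.
  + by move=> y; rewrite lee_fin sqr_ge0.
  + exact/measurable_EFinP/measurable_funX.
  by have := dotE f f; rewrite /= => <-; rewrite ltry.
Qed.

End semigroup.

(** * Time integrals and averaged Riemann sums *)

Section riemann.
Variable R : realType.
Local Notation leb := (@lebesgue_measure R).

Lemma lebesgue_measure_shift (a : R) (A : set R) : measurable A ->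
  pushforward leb (fun x : measurableTypeR R => x + a : measurableTypeR R) A =
  leb A.
Proof.
move=> mA; apply/esym/lebesgue_measure_unique => //=.
  exact: measurable_funD.
move=> ms _ [[x y]] _ <-.
rewrite /pushforward.
have -> : (fun z : R => z + a) @^-1` `]x, y]%classic = `](x - a), (y - a)]%classic.
  by apply/seteqP; split => z /=; rewrite !in_itv/= ltrBlDr lerBrDr.
rewrite !lebesgue_measure_itv/= !lte_fin ltrD2r; case: ifP => // _.
by rewrite -!EFinB; congr EFin; ring.
Qed.

Section bounded_function.
Variables (z : R -> R) (M : R).
Hypotheses (mz : measurable_fun setT z) (zM : forall x, `|z x| <= M).

Lemma bounded_integrable_itv (f : R -> R) (C a b : R) :
  measurable_fun setT f -> (forall x, `|f x| <= C) ->
  leb.-integrable `[a, b] (EFin \o f).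
Proof.
move=> mf fC; apply: measurable_bounded_integrable => //.
- by rewrite /= lebesgue_measure_itv/=; case: ifP => _; rewrite ?ltry// -EFinB ltry.
- exact: measurable_funTS.
- exists C; split; first exact: num_real.
  by move=> u Cu x _; exact: le_trans (fC x) (ltW Cu).
Qed.

Lemma Rintegral_shift (a h : R) :
  \int[leb]_(s in `[a, a + h]) z s = \int[leb]_(u in `[0, h]) z (a + u).
Proof.
have ms : measurable_fun setT (fun x : R => x + a) by exact: measurable_funD.
have ms' : measurable_fun setT (fun x : measurableTypeR R => x + a : measurableTypeR R).
  exact: ms.
congr fine.
have pre : (fun x : R => x + a) @^-1` `[a, a + h]%classic = `[0, h]%classic.
  by apply/seteqP; split => x /=; rewrite !in_itv/= lerDr [a + h]addrC lerD2r.
transitivity (\int[pushforward leb (fun x : measurableTypeR R => (x + a)%R : measurableTypeR R)]_(s in `[a, (a + h)%R]) (z s)%:E)%E.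
  by apply: eq_measure_integral => A mA _; exact/esym/lebesgue_measure_shift.
rewrite (integral_pushforward ms')//.
- by rewrite pre; apply: eq_integral => u _ /=; rewrite addrC.
- exact/measurable_EFinP.
- rewrite pre; apply: (@bounded_integrable_itv (fun x => z (x + a)) M) => //.
  exact: measurableT_comp mz ms.
Unshelve. all: exact: ms.
Qed.

Lemma Rintegral_grid (n : nat) (h : R) : 0 <= h ->
  \int[leb]_(s in `[0, n%:R * h]) z s =
  \sum_(k < n) \int[leb]_(u in `[0, h]) z (k%:R * h + u).
Proof.
move=> h0; elim: n => [|n IH].
  by rewrite mul0r set_itv1 Rintegral_set1 big_ord0.
have nh : 0 <= n%:R * h by rewrite mulr_ge0.
rewrite big_ord_recr/= -IH -Rintegral_shift.
rewrite -natr1 mulrDl mul1r.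
have iz := bounded_integrable_itv 0 (n%:R * h + h) mz zM.
rewrite -[X in _ = _ + X]Rintegral_itv_obnd_cbnd; last first.
  apply: integrableS (bounded_integrable_itv (n%:R * h) (n%:R * h + h) mz zM) => //.
  by apply: subset_itvr; rewrite bnd_simp.
rewrite -(Rintegral_itvB iz) ?bnd_simp ?lerDl//.
by rewrite [RHS]addrC subrK.
Qed.

Definition riemann_sum (n : nat) (h u : R) := \sum_(k < n) z (k%:R * h + u).

Lemma measurable_riemann_sum n h : measurable_fun setT (riemann_sum n h).
Proof.
apply: measurable_sum => k; apply: measurableT_comp mz _.
exact: measurable_funD.
Qed.

Lemma riemann_sum_le n h u : `|riemann_sum n h u| <= n%:R * M.
Proof.
rewrite (le_trans (ler_norm_sum _ _ _))//.
by rewrite (le_trans (ler_sum _ (fun k _ => zM _)))// sumr_const card_ord mulr_natl.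
Qed.

Lemma Rintegral_riemann_sum n h (b : R) :
  \int[leb]_(u in `[0, b]) riemann_sum n h u =
  \sum_(k < n) \int[leb]_(u in `[0, b]) z (k%:R * h + u).
Proof.
elim: n => [|n IH].
  rewrite (_ : riemann_sum 0 h = cst 0); last first.
    by apply/funext => u; rewrite /riemann_sum big_ord0.
  by rewrite Rintegral_cst// mul0r big_ord0.
rewrite (_ : riemann_sum n.+1 h = fun u => riemann_sum n h u + z (n%:R * h + u)).
  rewrite RintegralD//; first by rewrite IH big_ord_recr.
  - exact: bounded_integrable_itv (measurable_riemann_sum n h) (riemann_sum_le n h).
  - apply: (@bounded_integrable_itv _ M) => //.
    by apply: measurableT_comp mz _; exact: measurable_funD.
by apply/funext => u; rewrite /riemann_sum big_ord_recr.
Qed.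

(** Jensen's inequality for the exponential: the time integral is the mean,
    over the offset [u] in [0, h], of the Riemann sums on the shifted grid. *)
Lemma expR_integral_le (n : nat) (h : R) : 0 < h ->
  ((expR (\int[leb]_(s in `[0%R, (n%:R * h)%R]) z s))%:E <=
   h^-1%:E * \int[leb]_(u in `[0%R, h])
     (expR (h * riemann_sum n h u))%:E)%E.
Proof.
move=> h0; set c := Rintegral _ _ _.
pose y u := h * riemann_sum n h u.
have my : measurable_fun setT y.
  by apply: measurable_funM => //; exact: measurable_riemann_sum.
have yM u : `|y u| <= h * (n%:R * M).
  by rewrite normrM gtr0_norm// ler_pM2l// riemann_sum_le.
have iy := bounded_integrable_itv 0 h my yM.
have icst (r : R) : leb.-integrable `[0, h] (EFin \o cst r).
  exact: (@bounded_integrable_itv (cst r) `|r|).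
have ey : \int[leb]_(u in `[0, h]) y u = h * c.
  rewrite /y RintegralZl//; last first.
    exact: bounded_integrable_itv (measurable_riemann_sum n h) (riemann_sum_le n h).
  congr (h * _); rewrite /c Rintegral_grid ?ltW//.
  by rewrite Rintegral_riemann_sum.
pose C := expR c * (1 - c) .
have ilin : leb.-integrable `[0, h] (EFin \o (fun u => expR c * y u + C)).
  apply: (integrableD _ (integrableZl _ (expR c) iy) (icst C)) => //.
have Ilin : \int[leb]_(u in `[0, h]) (expR c * y u + C) = h * expR c.
  rewrite (RintegralD _ (integrableZl _ (expR c) iy) (icst C))//.
  rewrite RintegralZl// ey Rintegral_cst//= lebesgue_measure_itv/= lte_fin h0.
  by rewrite -EFinB/= /C; ring.
rewrite lee_pdivlMl// -EFinM -Ilin.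
have -> : (\int[leb]_(u in `[0, h]) (expR c * y u + C))%:E =
    (\int[leb]_(u in `[0%R, h]) (expR c * y u + C)%:E)%E.
  by rewrite fineK// integrable_fin_num.
have iexp : leb.-integrable `[0, h] (EFin \o (fun u => expR (y u))).
  apply: (@bounded_integrable_itv _ (expR (h * (n%:R * M)))).
    exact: measurableT_comp my.
  by move=> u; rewrite ger0_norm ?expR_ge0// ler_expR (le_trans (ler_norm _)).
apply: le_integral => // u _; rewrite lee_fin.
(* the exponential lies above its tangent line at c *)
have -> : expR (h * riemann_sum n h u) = expR c * expR (y u - c).
  by rewrite -expRD addrC subrK.
have := ler_wpM2l (expR_ge0 c) (expR_ge1Dx (y u - c)); rewrite /C; lra.
Qed.

End bounded_function.
End riemann.

(** * Exponential moments of time integrals *)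

Section path_integral.
Context d (E : measurableType d) dW (W : measurableType dW) (R : realType).
Variables (P : R.-pker E ~> W) (X : R -> W -> E).
Hypothesis mp : markov_process P X.
Local Notation leb := (@lebesgue_measure R).

Section bounded_observable.
Variables (v : E -> R) (k : R).
Hypotheses (mv : measurable_fun setT v) (vk : forall y, `|v y| <= k).

(** The process is only assumed to be measurable at nonnegative times. *)
Definition path_value (p : R * W) : R := if 0 <= p.1 then v (X p.1 p.2) else 0.

Lemma measurable_path_value : measurable_fun setT path_value.
Proof.
pose D := [set t : R | 0 <= t] `*` [set: W].
have mD : measurable D.
  apply: measurableX => //; rewrite (_ : [set t | _] = `[0%R, +oo[%classic)//.
  by apply/seteqP; split => r/=; rewrite in_itv/= andbT.
have mX : measurable_fun D (fun p => v (X p.1 p.2)).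
  exact: measurableT_comp mv (mp_measurable mp).
rewrite (_ : path_value = (fun p => v (X p.1 p.2)) \_ D).
  exact/(measurable_restrictT _ mD).
apply/funext => p; rewrite patchE /path_value; case: ifPn => p0.
  by rewrite ifT// inE; split.
by rewrite ifF//; apply/negbTE; apply: contra p0; rewrite inE => -[].
Qed.

Lemma path_value_le p : `|path_value p| <= k.
Proof.
rewrite /path_value; case: ifP => _ //.
by rewrite normr0 (le_trans _ (vk (X 0 point))).
Qed.

Lemma path_valueE s w : 0 <= s -> path_value (s, w) = v (X s w).
Proof. by rewrite /path_value /= => ->. Qed.

Lemma measurable_path_section w : measurable_fun setT (fun s => path_value (s, w)).
Proof.
exact: (measurableT_comp measurable_path_value (measurable_fun_pair (@measurable_id _ _ setT) (@measurable_cst _ _ _ _ setT w))).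
Qed.

Lemma path_integralE t w : \int[leb]_(s in `[0, t]) v (X s w) =
  \int[leb]_(s in `[0, t]) path_value (s, w).
Proof.
apply: eq_Rintegral => s; rewrite inE/= in_itv/= => /andP[s0 _].
by rewrite path_valueE.
Qed.

Lemma integrable_path t w :
  leb.-integrable `[0, t] (EFin \o (fun s => path_value (s, w))).
Proof.
exact: bounded_integrable_itv (measurable_path_section w)
  (fun s => path_value_le (s, w)).
Qed.

Lemma measurable_path_integral t : 0 <= t ->
  measurable_fun setT (fun w => \int[leb]_(s in `[0, t]) v (X s w)).
Proof.
move=> t0.
pose f (p : W * R) : \bar R := (\1_(`[0, t]%classic) p.2 * (path_value (p.2, p.1) + k))%:E.
have f0 p : (0 <= f p)%E.
  rewrite lee_fin mulr_ge0// -lerBlDr sub0r.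
  by have := path_value_le (p.2, p.1); rewrite ler_norml => /andP[].
have mf : measurable_fun setT f.
  apply/measurable_EFinP/measurable_funM.
    by apply: (measurableT_comp (measurable_indic _) measurable_snd).
  apply: measurable_funD => //.
  apply: measurableT_comp measurable_path_value _.
  exact: measurable_fun_pair.
have := @measurable_fun_fubini_tonelli_F _ _ _ _ _ leb f mf f0.
rewrite /fubini_F => mF.
rewrite (_ : (fun w => _) =
    fun w => fine (\int[leb]_u f (w, u))%E - k * t); last first.
  apply/funext => w; rewrite path_integralE; apply/eqP; rewrite eq_sym subr_eq eq_sym; apply/eqP.
  rewrite /f/=; under eq_integral do rewrite EFinM.
  rewrite integral_indic_mul -/(Rintegral _ _ _).
  have ic : leb.-integrable `[0, t] (EFin \o cst k).
    exact: (@bounded_integrable_itv _ (cst k) `|k|).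
  rewrite (RintegralD _ (integrable_path t w) ic)//; congr (_ + _).
  rewrite Rintegral_cst//= lebesgue_measure_itv/= lte_fin.
  by case: ltgtP t0 => [t1 _|//|<- _]; rewrite ?mulr0// -EFinB subr0.
apply: measurable_funB => //.
exact: measurableT_comp (fine_measurable measurableT) mF.
Qed.

(** By convexity and Tonelli's theorem, the exponential moment of the time
    integral is at most the mean, over the offset [u] in [0, h], of the
    functionals computed by the splitting scheme; so a bound on the latter that
    is uniform in [u] carries over. *)
Lemma exp_path_integral_le (nu : probability E R) (n : nat) (h a c : R) :
  0 < h -> (forall y, expR (h * v y) <= a + h * v y) -> 0 <= a ->
  (forall u, 0 <= u -> u <= h ->
    (\int[nu]_x transition P X u
      (iter n (split_step P X h (fun y => (a + h * v y)%:E)) (cst 1%E)) x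
     <= c%:E)%E) ->
  (\int[law P nu]_w (expR (\int[leb]_(s in `[0%R, (n%:R * h)%R]) v (X s w)))%:E
   <= c%:E)%E.
Proof.
move=> h0 ev a0 Hc.
have c0 : 0 <= c.
  rewrite -lee_fin (le_trans _ (Hc 0 (lexx _) (ltW h0)))//.
  apply: integral_ge0 => x _; apply: transition_ge0 => y.
  elim: n {Hc} y => [//|n IH] y /=; apply: mule_ge0; last exact: transition_ge0.
  by rewrite lee_fin (le_trans (expR_ge0 _) (ev y)).
pose G y := (a + h * v y)%:E.
have G0 y : (0 <= G y)%E by rewrite lee_fin (le_trans (expR_ge0 _) (ev y)).
have mG : measurable_fun setT G.
  by apply/measurable_EFinP/measurable_funD => //; exact: measurable_funM.
pose F (p : W * R) : R := \1_(`[0, h]%classic) p.2 *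
  \prod_(j < n) (a + h * path_value (j%:R * h + p.2, p.1)).
have F0 p : (0 <= (EFin \o F) p)%E.
  rewrite lee_fin mulr_ge0// prodr_ge0// => j _; rewrite /path_value.
  by case: ifP => _; rewrite ?mulr0 ?addr0// -lee_fin; exact: G0.
have mF : measurable_fun setT (EFin \o F).
  apply/measurable_EFinP/measurable_funM.
    by apply: (measurableT_comp (measurable_indic _) measurable_snd).
  apply: measurable_prod => j _; apply: measurable_funD => //.
  apply: measurable_funM => //.
  apply: measurableT_comp measurable_path_value _.
  apply: measurable_fun_pair => //; exact: measurable_funD.
have FE u w : u \in `[0, h]%classic ->
    (\prod_(j < n) (a + h * path_value (j%:R * h + u, w)))%:E =
    grid_prod X u h G n w.
  rewrite inE/= in_itv/= => /andP[u0 _].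
  rewrite /grid_prod -prodEFin; apply: eq_bigr => j _.
  by rewrite path_valueE// addr_ge0// mulr_ge0// ltW.
rewrite (@le_trans _ _ (\int[law P nu]_w (h^-1%:E * \int[leb]_u (EFin \o F) (w, u)))%E)//.
  apply: ge0_le_integral => //.
  - apply/measurable_EFinP; apply: measurableT_comp => //.
    by apply: measurable_path_integral; rewrite mulr_ge0// ltW.
  - apply: measurable_funeM.
    exact: (@measurable_fun_fubini_tonelli_F _ _ _ _ _ leb _ mF F0).
  - move=> w _; rewrite path_integralE.
    have := expR_integral_le (measurable_path_section w) (fun s => path_value_le (s, w)) n h0.
    move=> /le_trans; apply; rewrite lee_wpmul2l ?lee_fin ?invr_ge0 ?(ltW h0)//.
    rewrite /F/=; under [leRHS]eq_integral do rewrite EFinM.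
    rewrite integral_indic_mul; apply: ge0_le_integral => //.
    + apply/measurable_EFinP/measurable_funTS; apply: measurableT_comp => //.
      apply: measurable_funM => //; apply: measurable_riemann_sum.
      exact: measurable_path_section.
    + apply/measurable_EFinP/measurable_funTS.
      apply: measurable_prod => j _; apply: measurable_funD => //.
      apply: measurable_funM => //.
      apply: measurableT_comp (measurable_path_section w) _.
      exact: measurable_funD.
    + move=> u; rewrite /= in_itv/= => /andP[u0 _]; rewrite lee_fin.
      rewrite /riemann_sum mulr_sumr expR_sum; apply: ler_prod => j _.
      by rewrite expR_ge0/= path_valueE// addr_ge0// mulr_ge0// ltW.
have -> : (\int[law P nu]_w (h^-1%:E * \int[leb]_u (EFin \o F) (w, u)) =
    h^-1%:E * \int[law P nu]_w \int[leb]_u (EFin \o F) (w, u))%E.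
  apply: ge0_integralZl => //.
  - exact: (@measurable_fun_fubini_tonelli_F _ _ _ _ _ leb _ mF F0).
  - by move=> w _; exact: integral_ge0.
  - by rewrite lee_fin invr_ge0 ltW.
rewrite fubini_tonelli//= lee_pdivrMl// -EFinM.
have -> : (h * c)%:E = (\int[leb]_u ((\1_(`[0%R, h]%classic) u)%:E * c%:E))%E.
  rewrite integral_indic_mul integral_cst//= lebesgue_measure_itv/= lte_fin h0.
  by rewrite -EFinB subr0 -EFinM mulrC.
apply: ge0_le_integral => //.
- by move=> u _; apply: integral_ge0 => w _; exact: (F0 (w, u)).
- exact: (@measurable_fun_fubini_tonelli_G _ _ _ _ _ (law P nu) _ mF F0).
- apply: emeasurable_funM => //; apply/measurable_EFinP; exact: measurable_indic.
move=> u _; have [uh|uh] := boolP (u \in `[0, h]%classic); last first.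
  rewrite integral0_eq => [|w _]; first by rewrite indicE (negbTE uh) mul0e.
  by rewrite /F/= indicE (negbTE uh) mul0r.
rewrite indicE uh mul1e.
have uh' : u <= h by move: uh; rewrite inE/= in_itv/= => /andP[].
have u0 : 0 <= u by move: uh; rewrite inE/= in_itv/= => /andP[].
apply: le_trans (Hc u u0 uh').
have -> : (\int[law P nu]_w (F (w, u))%:E = \int[law P nu]_w grid_prod X u h G n w)%E.
  by apply: eq_integral => w _; rewrite -FE// /F/= indicE uh mul1r.
rewrite integral_law; last 2 first.
- by move=> w; exact: grid_prod_ge0.
- exact: (measurable_grid_prod mp u0 (ltW h0) mG).
rewrite le_eqVlt; apply/orP; left; apply/eqP/eq_integral => x _.
rewrite -(integral_grid_prod mp u0 (ltW h0) G0 mG)//.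
by apply: eq_integral => w _; rewrite mule1.
Qed.

End bounded_observable.
End path_integral.

(** * Change of initial distribution *)

Section density.
Context d (E : measurableType d) (R : realType) (mu nu : probability E R).
Hypothesis numu : nu `<< mu.
Local Notation density := ('d (charge_of_finite_measure nu) '/d mu).

(** Cauchy-Schwarz inequality for the density of [nu]. *)
Lemma integral_density_le (g : E -> R) (C : R) : measurable_fun setT g ->
  (forall x, 0 <= g x) -> (forall x, g x <= C) ->
  (\int[nu]_x (g x)%:E <= 'N[mu]_2%:E[density] * 'N[mu]_2%:E[EFin \o g])%E.
Proof.
move=> mg g0 gC.
have Dfin x : density x \is a fin_num by exact: Radon_Nikodym_fin_num.
have /integrableP[mD _] := Radon_Nikodym_integrable
  (nu := charge_of_finite_measure nu) numu.
have mD' : measurable_fun setT (fine \o density).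
  exact: measurableT_comp (fine_measurable measurableT) mD.
have DE : EFin \o (fine \o density) = density.
  by apply/funext => x /=; rewrite fineK.
have ig : nu.-integrable setT (EFin \o g).
  apply: measurable_bounded_integrable => //.
    by rewrite ltey_eq fin_num_measure.
  exists C; split; first exact: num_real.
  have gC' x : `|g x| <= C by rewrite ger0_norm.
  by move=> u Cu x _; exact: le_trans (gC' x) (ltW Cu).
rewrite -(Radon_Nikodym_change_of_variables numu measurableT ig) muleC.
rewrite -{2}DE (le_trans _ (hoelder mu mg mD' _ _ _))//; last first.
  by rewrite [RHS]splitr !div1r.
rewrite Lnorm1 (le_trans (lee_abs _))// (le_trans (le_abse_integral _ _ _))//.
  by apply: emeasurable_funM => //; exact/measurable_EFinP.
rewrite le_eqVlt; apply/orP; left; apply/eqP/eq_integral => x _.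
by rewrite -[in LHS](fineK (Dfin x)).
Qed.

Lemma density_norm_ge1 : (1 <= 'N[mu]_2%:E[density])%E.
Proof.
have := @integral_density_le (cst 1) 1 (@measurable_cst _ _ _ _ _ _)
  (fun=> ler01) (fun=> lexx _).
rewrite -[X in (X <= _)%E]/(\int[nu]_x (cst 1%E x))%E integral_cst// mul1e.
rewrite [X in (X <= _)%E](_ : _ = 1%E); last exact: probability_setT.
suff -> : 'N[mu]_2%:E[EFin \o cst 1%R]%E = 1%E by rewrite mule1.
rewrite (_ : EFin \o cst 1 = cst 1%E)// Lnorm_cst1.
by rewrite [X in (X `^ _)%E](_ : _ = 1%E) ?poweR1r//; exact: probability_setT.
Qed.

End density.

Lemma cvg_at_right0P (R : realType) (u : R -> \bar R) (F : R -> R) :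
  (forall t, 0 < t -> u t = (F t)%:E) -> (forall t, 0 <= F t) ->
  u t @[t --> 0^'+] --> 0%E <->
  (forall e : R, 0 < e ->
    exists2 a : R, 0 < a & forall t : R, 0 < t -> t < a -> F t <= e).
Proof.
move=> uF F0; rewrite -[0%E]/(0%:E); split.
  move=> /fine_cvgP[_ /cvgrPdist_le cF] e e0.
  have [a /= a0 ha] := cF e e0; exists a => // t t0 ta.
  have := ha t; rewrite /= sub0r normrN gtr0_norm// => /(_ ta t0).
  by rewrite sub0r normrN uF//= ger0_norm.
move=> H; apply: cvg_EFin.
  by near=> t; rewrite uF.
apply/cvgrPdist_le => e e0; have [a a0 ha] := H e e0.
near=> t; rewrite /= uF//= sub0r normrN ger0_norm// ha//.
Unshelve. all: by end_near. Qed.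

Section multiplication.
Context d (E : measurableType d) (R : realType) (mu : probability E R).
Variables (v : E -> R) (k : R).
Hypotheses (mv : measurable_fun setT v) (vk : forall y, `|v y| <= k).

Let k0 : 0 <= k. Proof. exact: le_trans (normr_ge0 _) (vk point). Qed.

Lemma sqr_mul_le (f : E -> R) x : (v x * f x) ^+ 2 <= k ^+ 2 * f x ^+ 2.
Proof.
rewrite exprMn ler_wpM2r ?sqr_ge0// -real_normK ?num_real//.
by rewrite ler_sqr ?nnegrE.
Qed.

Lemma integral_sqr_mul_le (f : L2 mu) :
  (\int[mu]_x ((v x * f x) ^+ 2)%:E <= (k ^+ 2 * dot mu f f)%:E)%E.
Proof.
have mf := measurable_L2 f.
rewrite EFinM dotE -ge0_integralZl//; last 3 first.
- by apply/measurable_EFinP; exact: measurable_funM.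
- by move=> x _; rewrite lee_fin -expr2 sqr_ge0.
- by rewrite lee_fin sqr_ge0.
apply: ge0_le_integral => //.
- by move=> x _; rewrite lee_fin sqr_ge0.
- by apply/measurable_EFinP/measurable_funX; exact: measurable_funM.
- by apply/measurable_EFinP; apply: measurable_funM => //; exact: measurable_funM.
- by move=> x _; rewrite -EFinM lee_fin -expr2 sqr_mul_le.
Qed.

Lemma ex_multiplication : exists M : L2 mu -> L2 mu,
  forall f, M f = (fun x => v x * f x) :> (E -> R).
Proof.
suff /choice[M ME] : forall f : L2 mu, exists g : L2 mu,
  g = (fun x => v x * f x) :> (E -> R) by exists M.
move=> f; apply: ex_L2.
  by apply: measurable_funM => //; exact: measurable_L2.
by rewrite (le_lt_trans (integral_sqr_mul_le f))// ltry.
Qed.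

End multiplication.

(** * The generator and the bounded operator *)

Section operators.
Context d (E : measurableType d) dW (W : measurableType dW) (R : realType).
Variables (P : R.-pker E ~> W) (X : R -> W -> E) (mu : probability E R).
Variables (rho : R) (S : L2 mu -> L2 mu).
Local Notation q := (fun f g : L2 mu => dot mu f g).
Local Notation nrm := (seminorm q).
Implicit Types f g u : L2 mu.
Variable e : L2 mu.
Hypothesis eE : e = cst 1 :> (E -> R).

Let sfq := sf_dot mu.
Let q_ge0 := @dot_ge0 _ _ _ mu.

Lemma dot_unit : dot mu e e = 1.
Proof.
rewrite -[RHS](mean_cst mu 1); apply: eq_Rintegral => x _.
by rewrite eE/= mulr1.
Qed.

Lemma avg_mean f : avg q e f = mean mu f.
Proof. by apply: eq_Rintegral => x _; rewrite eE/= mul1r. Qed.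

Lemma norm2_centered f : norm2 mu (centered mu f) = Num.sqrt (var q e f).
Proof.
rewrite -(seminorm_center sfq dot_unit f) -norm2E; congr norm2.
apply/funext => x; rewrite -[RHS]/(f x - avg q e f * e x).
by rewrite eE/= mulr1 avg_mean.
Qed.

Let var_ge0' f : 0 <= var q e f.
Proof. exact: (var_ge0 sfq q_ge0 dot_unit). Qed.

Section bounded_operator.
Hypothesis Sbso : bounded_symmetric_operator S.
Hypothesis dens : generator_dense P X mu.
Hypothesis S_gen : forall f Lf : L2 mu, generator P X f Lf ->
  norm2 mu (S f) <= 2^-1 * norm2 mu (centered mu f).

Lemma sqrt_varD f g :
  Num.sqrt (var q e (f + g)) <= Num.sqrt (var q e f) + Num.sqrt (var q e g).
Proof.
have c_ge0 u : 0 <= cov q e u u by rewrite covE var_ge0'.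
by have := seminormD (sf_cov e sfq) c_ge0 f g; rewrite /seminorm !covE.
Qed.

(** The hypothesis on [S], given on the domain of the generator, extends to all
    functions by density, since [S] is bounded and the standard deviation is
    1-Lipschitz. *)
Lemma S_bound f : nrm (S f) <= 2^-1 * Num.sqrt (var q e f).
Proof.
have [C SC] := bso_bounded Sbso.
apply/ler_addgt0Pr => eta eta0.
pose c := `|C| + 1.
have c0 : 0 < c by rewrite ltr_wpDl.
pose dl := eta / c.
have dl0 : 0 < dl by rewrite divr_gt0.
have [u [Lu uLu] fu] := dens f dl0.
rewrite -[norm2 mu _]/(norm2 mu (f - u)) norm2E in fu.
have uE : nrm (S f) <= nrm (S u) + nrm (S (f - u)).
  have Sfu : S f = S u + S (f - u) %[ae mu].
    by have := bso_add Sbso u (f - u); rewrite [u + _]addrC subrK.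
  by rewrite (ind_seminorm sfq q_ge0 (ind_ae_eq Sfu)) (seminormD sfq).
have Su : nrm (S u) <= 2^-1 * (Num.sqrt (var q e f) + dl).
  rewrite -norm2E (le_trans (S_gen uLu))// norm2_centered ler_pM2l//.
  have := sqrt_varD f (u - f); rewrite addrC subrK => /le_trans; apply.
  rewrite lerD2l (le_trans (sqrt_var_le q e _))// -opprB -scaleN1r.
  by rewrite (seminormZ sfq) normrN1 mul1r ltW.
have Sfu : nrm (S (f - u)) <= `|C| * dl.
  have := SC (f - u); rewrite !norm2E => /le_trans; apply.
  rewrite (@le_trans _ _ (`|C| * nrm (f - u)))//.
    by rewrite ler_wpM2r ?seminorm_ge0// ler_norm.
  by rewrite ler_wpM2l// ltW.
have : c * dl = eta by rewrite /dl mulrCA divff ?mulr1// gt_eqF.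
rewrite /c => cdl; lra.
Qed.

(** [S] kills constants; by symmetry its range is centered. *)
Lemma S_unit g : dot mu e (S g) = 0.
Proof.
rewrite -(bso_symmetric Sbso).
have : nrm (S e) <= 0.
  rewrite (le_trans (S_bound _))//.
  by rewrite /var /avg dot_unit expr1n subrr sqrtr0 mulr0.
move=> Se; apply/eqP; rewrite -normr_le0.
rewrite (le_trans (seminorm_cs sfq q_ge0 (S e) g))//.
by rewrite mulr_le0_ge0 ?seminorm_ge0.
Qed.

Lemma sf_S : symmetric_bilinear (fun f g => dot mu f (S g)).
Proof.
split=> [f g|f g h|a f h].
- by rewrite -(bso_symmetric Sbso) (sf_sym sfq).
- exact: (sf_add sfq).
- exact: (sf_scale sfq).
Qed.

Lemma S_le f g : `|dot mu f (S g)| <=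
  2^-1 * (Num.sqrt (var q e f) * Num.sqrt (var q e g)).
Proof.
have -> : dot mu f (S g) = q (f - avg q e f *: e) (S g).
  by rewrite (sf_add sfq) (sf_opp sfq) (sf_scale sfq) S_unit mulr0 subr0.
rewrite (le_trans (seminorm_cs sfq q_ge0 _ _))//.
rewrite (seminorm_center sfq dot_unit) mulrCA ler_wpM2l ?sqrtr_ge0//.
exact: S_bound.
Qed.

End bounded_operator.

Section markov_semigroup.
Hypotheses (mp : markov_process P X) (cons : conservative P X).
Hypothesis inv : invariant_probability P X mu.
Variable T : R -> L2 mu -> L2 mu.
Hypothesis TE : forall t f, 0 <= t -> T t f = semigroup P X t f :> (E -> R).
Local Notation "f ~~ g" := (indistinguishable q f g) (at level 70).

Lemma TD t f g : 0 <= t -> T t (f + g) ~~ T t f + T t g.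
Proof.
move=> t0; apply: ind_ae_eq; rewrite TE//.
have := ae_semigroup_linear mp inv 1 t0 (integrable_L2 f) (integrable_L2 g).
apply: filterS => x fgx _.
rewrite -[RHS]/(T t f x + T t g x) !TE// -[semigroup P X t f x]mul1r -fgx.
by congr (semigroup P X t _ x); apply/funext => y; rewrite mul1r.
Qed.

Lemma TZ t a f : 0 <= t -> T t (a *: f) ~~ a *: T t f.
Proof.
move=> t0; apply: ind_ae_eq; rewrite TE//.
have i0 := integrable_L2 (0 : L2 mu).
have := ae_semigroup_linear mp inv a t0 (integrable_L2 f) i0.
apply: filterS => x fx _.
rewrite -[RHS]/(a * T t f x) TE//.
have -> : semigroup P X t (a *: f) x =
    semigroup P X t (fun y => a * f y + (0 : L2 mu) y) x.
  by congr (semigroup P X t _ x); apply/funext => y; rewrite /= addr0.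
rewrite fx; suff -> : semigroup P X t (0 : L2 mu) x = 0 by rewrite addr0.
by rewrite /semigroup Rintegral_cst// mul0r.
Qed.

Lemma T_le t f : 0 <= t -> q (T t f) (T t f) <= q f f.
Proof.
move=> t0; have mf := measurable_L2 f; rewrite -lee_fin !dotE TE//.
have f20 y : (0 <= (f y ^+ 2)%:E)%E by rewrite lee_fin sqr_ge0.
have mf2 : measurable_fun setT (fun y => (f y ^+ 2)%:E).
  exact/measurable_EFinP/measurable_funX.
rewrite -[leRHS](integral_transition mp inv t0 f20 mf2).
apply: ge0_le_integral => //.
- by move=> x _; rewrite lee_fin -expr2 sqr_ge0.
- apply/measurable_EFinP; apply: measurable_funM; exact: measurable_semigroup.
- exact: measurable_transition.
- by move=> x _; rewrite -expr2; exact: sqr_semigroup_le.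
Qed.

Lemma T_semi s t f : 0 <= s -> 0 <= t -> T (s + t) f ~~ T s (T t f).
Proof.
move=> s0 t0; apply: ind_ae_eq.
rewrite TE ?addr_ge0// TE// TE//.
exact: (semigroupD mp inv s0 t0 (integrable_L2 f)).
Qed.

Lemma T0 f : T 0 f ~~ f.
Proof.
apply: ind_ae_eq; apply: aeW => x _; rewrite TE//.
have mf : measurable_fun setT (EFin \o f) := measurable_int mu (integrable_L2 f).
rewrite -[LHS]/(fine (transition P X 0 (EFin \o f) x)) transition_posneg.
rewrite !(transition0 mp)//.
- by rewrite -[RHS]/(fine ((EFin \o f) x)) [in RHS](funeposneg (EFin \o f)).
- exact: measurable_funeneg.
- exact: measurable_funepos.
Qed.

Lemma T_one t : 0 <= t -> T t e ~~ e.
Proof.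
by move=> t0; apply: ind_ae_eq; apply: aeW => x _; rewrite TE// eE cons.
Qed.

Lemma generatorP f g : generator P X f g <-> forall c : R, 0 < c ->
  exists2 a : R, 0 < a &
    forall h : R, 0 < h -> h < a -> nrm (h^-1 *: (T h f - f) - g) <= c.
Proof.
apply: cvg_at_right0P; last by move=> t; exact: seminorm_ge0.
move=> t t0; rewrite -Lnorm2E; congr Lnorm; apply/funext => x /=.
by rewrite TE// ltW.
Qed.

Lemma generator_densityP (dens : generator_dense P X mu) f (c : R) : 0 < c ->
  exists2 u, exists g, generator P X u g & nrm (f - u) < c.
Proof. by move=> /(dens f)[u ug fu]; exists u => //; rewrite -norm2E. Qed.

End markov_semigroup.

End operators.

(** * The deviation inequality *)

(** From [1 - y <= expR (- y)] and [1 <= (1 - y) * (1 + y + 2 * y ^+ 2)]. *)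
Lemma expR_le_quadratic (R : realType) (y : R) : y <= 2^-1 ->
  expR y <= 1 + y + 2 * y ^+ 2.
Proof.
move=> y2; have h1 : 0 < 1 - y by lra.
have h2 : (1 - y) * expR y <= 1.
  rewrite -[leRHS]expR0 -(addNr y) expRD ler_wpM2r ?expR_ge0//.
  by have := expR_ge1Dx (- y).
rewrite -(ler_pM2l h1) (le_trans h2)//.
have : 0 <= y ^+ 2 * (1 - 2 * y) by rewrite mulr_ge0 ?sqr_ge0//; lra.
lra.
Qed.

Section small_mesh.
Variables (R : realType) (k Lam : R).
Hypotheses (k0 : 0 <= k) (Lam0 : 0 <= Lam).

(** The constant term that makes [drift h + h * y], which is affine in [y], an
    upper bound of [expR (h * y)] when [`|y| <= k] and [h * k <= 2^-1]. *)
Definition drift (h : R) := 1 + 2 * k ^+ 2 * h ^+ 2.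
(** The factor of [perturbed_step] with [a := drift h]. *)
Definition growth (h : R) :=
  drift h ^+ 2 + 2 * drift h * h * Lam + 3 * k ^+ 2 * h ^+ 2.
Definition mesh_error := 7 * k ^+ 2 + 4 * k ^+ 4 + 4 * k ^+ 2 * Lam.

Lemma mesh_error_ge0 : 0 <= mesh_error.
Proof. by rewrite !addr_ge0 ?mulr_ge0 ?exprn_ge0. Qed.

Lemma drift_ge1 h : 1 <= drift h.
Proof. by rewrite /drift lerDl mulr_ge0 ?sqr_ge0// mulr_ge0 ?sqr_ge0. Qed.

Lemma growth_ge0 h : 0 <= h -> 0 <= growth h.
Proof.
move=> h0; have d0 : 0 <= drift h := le_trans ler01 (drift_ge1 h).
apply: addr_ge0; first by rewrite addr_ge0 ?sqr_ge0// !mulr_ge0.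
by rewrite mulr_ge0 ?sqr_ge0// mulr_ge0 ?sqr_ge0.
Qed.

Lemma growth_le h : 0 <= h -> h <= 1 ->
  growth h <= expR (2 * Lam * h + mesh_error * h ^+ 2).
Proof.
move=> h0 h1; apply: le_trans (expR_ge1Dx _).
have h20 : 0 <= h ^+ 2 by rewrite sqr_ge0.
have h21 : h ^+ 2 <= 1 by rewrite expr_le1.
have k4 : 0 <= k ^+ 4 by rewrite exprn_ge0.
have e1 : k ^+ 4 * (h ^+ 2 * h ^+ 2) <= k ^+ 4 * h ^+ 2.
  by rewrite ler_wpM2l// ler_piMr.
have kl : 0 <= k ^+ 2 * Lam by rewrite mulr_ge0 ?sqr_ge0.
have e2 : k ^+ 2 * Lam * (h * h ^+ 2) <= k ^+ 2 * Lam * h ^+ 2.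
  by rewrite ler_wpM2l// ler_piMl.
rewrite /growth /drift /mesh_error; lra.
Qed.

Lemma drift_expR h y : 0 <= h -> h * k <= 2^-1 -> `|y| <= k ->
  expR (h * y) <= drift h + h * y.
Proof.
move=> h0 hk yk.
have hy : h * y <= 2^-1.
  rewrite (le_trans _ hk)// ler_wpM2l// (le_trans _ yk)//; exact: ler_norm.
rewrite (le_trans (expR_le_quadratic hy))// /drift.
have : y ^+ 2 <= k ^+ 2.
  by rewrite -real_normK ?num_real// ler_sqr ?nnegrE// (le_trans _ yk).
move=> /(ler_wpM2l (sqr_ge0 h)); lra.
Qed.

(** The exponent tends to [t * Lam] when [t = n%:R * h] is fixed and [h] tends
    to 0. *)
Lemma sqrt_growth_le (n : nat) h : 0 <= h -> h <= 1 ->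
  Num.sqrt (2 * growth h ^+ n) <=
  Num.sqrt 2 * expR (n%:R * h * Lam + n%:R * h * (mesh_error * h / 2)).
Proof.
move=> h0 h1.
have K0 : 0 <= growth h by exact: growth_ge0.
set x := _ + _ : R.
have -> : Num.sqrt 2 * expR x = Num.sqrt (2 * expR x ^+ 2).
  by rewrite sqrtrM// sqrtr_sqr ger0_norm// expR_ge0.
rewrite ler_wsqrtr// ler_pM2l// (@le_trans _ _ (expR (2 * Lam * h + mesh_error * h ^+ 2) ^+ n))//.
  by rewrite lerXn2r ?nnegrE ?expR_ge0 ?growth_le.
rewrite -!expRM_natl ler_expR le_eqVlt; apply/orP; left; apply/eqP.
by rewrite /x; field.
Qed.

End small_mesh.

Section deviation.
Context d (E : measurableType d) dW (W : measurableType dW) (R : realType).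
Variables (P : R.-pker E ~> W) (X : R -> W -> E) (mu : probability E R).
Variables (rho : R) (S : L2 mu -> L2 mu).
Hypotheses (mp : markov_process P X) (cons : conservative P X).
Hypotheses (inv : invariant_probability P X mu) (dens : generator_dense P X mu).
Hypotheses (rho0 : 0 < rho) (Sbso : bounded_symmetric_operator S).
Hypothesis S_gen : forall f Lf : L2 mu, generator P X f Lf ->
  norm2 mu (S f) <= 2^-1 * norm2 mu (centered mu f) /\
  dot mu f (Lf \+ S Lf) <= - rho * norm2 mu (centered mu f) ^+ 2.
Local Notation leb := (@lebesgue_measure R).
Local Notation q := (fun f g : L2 mu => dot mu f g).
Local Notation s := (fun f g : L2 mu => dot mu f (S g)).
Local Notation B := (modified q s).
Local Notation nrm := (seminorm q).

Lemma semigroup_bounded t (g : E -> R) (C : R) x : 0 <= t ->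
  measurable_fun setT g -> (forall y, 0 <= g y) -> (forall y, g y <= C) ->
  [/\ (semigroup P X t g x)%:E = transition P X t (EFin \o g) x,
      0 <= semigroup P X t g x & semigroup P X t g x <= C].
Proof.
move=> t0 mg g0 gC.
have Q0 : (0 <= transition P X t (EFin \o g) x)%E.
  by apply: transition_ge0 => y; rewrite lee_fin.
have QC : (transition P X t (EFin \o g) x <= C%:E)%E.
  rewrite -(transition_cst P X t C x); apply: (le_transition mp t0) => //.
  exact/measurable_EFinP.
have sE : (semigroup P X t g x)%:E = transition P X t (EFin \o g) x.
  by rewrite fineK// ge0_fin_numE// (le_lt_trans QC)// ltry.
by split=> //; rewrite -lee_fin sE.
Qed.

Section perturbed.
Variables (v : E -> R) (k sig Lam : R).
Hypotheses (mv : measurable_fun setT v) (vk : forall y, `|v y| <= k).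
Hypothesis v_mean : mean mu v = 0.
Hypothesis v_norm : norm2 mu v <= sig.
Hypothesis Lam0 : 0 <= Lam.
Hypothesis rate_le : forall x y : R, 0 <= x -> 0 <= y ->
  5 / 2 * sig * (x * y) + 3 / 2 * k * y ^+ 2 <= rho * y ^+ 2 + Lam * x ^+ 2.

Let k0 : 0 <= k. Proof. exact: le_trans (normr_ge0 _) (vk point). Qed.

(** [perturbed_step] for the semigroup at time [h] and the multiplication by
    [v]. *)
Lemma splitting_step h : 0 < h -> exists T M : L2 mu -> L2 mu,
  [/\ forall f, T f = semigroup P X h f :> (E -> R),
      forall f, M f = (fun x => v x * f x) :> (E -> R) &
      forall f, let g := drift k h *: T f + h *: M (T f) in
        B g g <= growth k Lam h * B f f].
Proof.
move=> h0.
have [e eE] := ex_L2_cst mu 1.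
have [T TE] := ex_semigroup_L2 mp inv.
have [M ME] := ex_multiplication mu mv vk.
have sfq := sf_dot mu; have q_ge0 := @dot_ge0 _ _ _ mu.
have qee := dot_unit eE.
have S_gen1 f Lf (gf : generator P X f Lf) := (S_gen gf).1.
have sfs := sf_S Sbso.
have s_le := S_le eE Sbso dens S_gen1.
exists (T h), M; split => //; first by move=> f; rewrite TE// ltW.
have M_sym f g : q (M f) g = q f (M g).
  by apply: eq_Rintegral => x _; rewrite !ME; ring.
have M_unit : M e = v :> (E -> R).
  by rewrite ME; apply/funext => x; rewrite eE/= mulr1.
have M_avg : avg q e (M e) = 0 by rewrite avg_mean// M_unit.
have M_e : nrm (M e) <= sig by rewrite -norm2E M_unit.
have M_norm f : nrm (M f) <= k * nrm f.
  rewrite -ler_sqr ?nnegrE ?mulr_ge0 ?seminorm_ge0//.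
  rewrite exprMn !seminorm_sqr// -lee_fin.
  rewrite dotE (le_trans _ (integral_sqr_mul_le mv vk f))// ME.
  rewrite le_eqVlt; apply/orP; left; apply/eqP.
  by apply: eq_integral => x _; rewrite expr2.
have D_dis f g : generator P X f g -> B f g <= - rho * var q e f.
  move=> gfg; have := (S_gen gfg).2.
  rewrite (norm2_centered eE) sqr_sqrtr ?(var_ge0 sfq q_ge0 qee)//.
  apply: le_trans; rewrite le_eqVlt; apply/orP; left; apply/eqP.
  by rewrite -[RHS]/(dot mu f (g + S g)) (sf_addr sfq).
have a1 := drift_ge1 k h.
move=> f; exact: (perturbed_step sfq q_ge0 qee sfs s_le (TD mp inv TE)
  (TZ mp inv TE) (T_le mp inv TE) (T_semi mp inv TE) (T0 mp TE)
  (T_one eE cons TE) (generatorP TE) (ltW rho0) D_dis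
  (generator_densityP dens) M_sym M_avg M_e M_norm k0 Lam0 rate_le f h0 a1).
Qed.

(** The iterates started from the constant function 1 are bounded functions, so
    that their integrals with respect to [nu] make sense, and their norm grows
    geometrically. *)
Lemma splitting_iterates h n : 0 < h -> h * k <= 2^-1 ->
  exists g : L2 mu, [/\
    forall x, (g x)%:E = iter n (split_step P X h
      (fun y => (drift k h + h * v y)%:E)) (cst 1%E) x,
    forall x, 0 <= g x, exists C, forall x, g x <= C &
    dot mu g g <= 2 * growth k Lam h ^+ n].
Proof.
move=> h0 hk.
have [T [M [TE ME step]]] := splitting_step h0.
suff [g [gE g0 gC gB]] : exists g : L2 mu, [/\
    forall x, (g x)%:E = iter n (split_step P X h
      (fun y => (drift k h + h * v y)%:E)) (cst 1%E) x,
    forall x, 0 <= g x, exists C, forall x, g x <= C &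
    B g g <= growth k Lam h ^+ n].
  exists g; split=> //.
  have [e eE] := ex_L2_cst mu 1.
  have S_gen1 f Lf (gf : generator P X f Lf) := (S_gen gf).1.
  rewrite (le_trans (sqr_le_modified (sf_dot mu) (@dot_ge0 _ _ _ mu)
    (dot_unit eE) (S_le eE Sbso dens S_gen1) g))//.
  by rewrite ler_pM2l.
elim: n => [|n [g [gE g0 [C gC] gB]]].
  have [e eE] := ex_L2_cst mu 1.
  have S_gen1 f Lf (gf : generator P X f Lf) := (S_gen gf).1.
  exists e; split; [by move=> x; rewrite eE|by move=> x; rewrite eE| |].
    by exists 1 => x; rewrite eE.
  rewrite expr0 (@modified_unit _ _ q s e (dot_unit eE)
    (S_le eE Sbso dens S_gen1)).
  by rewrite avg_mean// eE mean_cst.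
have mg := measurable_L2 g.
have G0 y : 0 <= drift k h + h * v y.
  by rewrite (le_trans (expR_ge0 _) (drift_expR k0 (ltW h0) hk (vk y))).
pose g' := drift k h *: T g + h *: M (T g).
have g'E x : g' x = (drift k h + h * v x) * semigroup P X h g x.
  rewrite -[LHS]/(drift k h * T g x + h * M (T g) x) ME TE; ring.
have sgP x := semigroup_bounded x (ltW h0) mg g0 gC.
exists g'; split.
- move=> x; have [sE s0 sC] := sgP x; rewrite g'E EFinM sE iterS.
  rewrite [RHS]/split_step; congr (_ * _)%E.
  by apply: eq_integral => w _; rewrite -gE.
- by move=> x; have [_ s0 _] := sgP x; rewrite g'E mulr_ge0.
- exists ((drift k h + h * k) * C) => x; have [_ s0 sC] := sgP x.
  rewrite g'E ler_pM// lerD2l ler_pM2l// (le_trans _ (vk x))//.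
  exact: ler_norm.
- rewrite exprS (le_trans (step g))// ler_wpM2l//.
  by apply: growth_ge0 => //; exact: ltW.
Qed.

Variable nu : probability E R.
Hypothesis numu : nu `<< mu.
Local Notation density := ('d (charge_of_finite_measure nu) '/d mu).

Lemma exp_moment_le (N h : R) n : 0 < h -> h * k <= 2^-1 ->
  'N[mu]_2%:E[density]%E = N%:E ->
  (\int[law P nu]_w
    (expR (\int[leb]_(s in `[0%R, (n%:R * h)%R]) v (X s w)))%:E <=
   (N * Num.sqrt (2 * growth k Lam h ^+ n))%:E)%E.
Proof.
move=> h0 hk NE; have hh := ltW h0.
have [g [gE g0 [C gC] gB]] := splitting_iterates n h0 hk.
have mg := measurable_L2 g.
apply: (exp_path_integral_le mp mv vk h0 _ _ _) => [y||u u0 uh].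
- exact: (drift_expR k0 hh hk (vk y)).
- exact: le_trans ler01 (drift_ge1 k h).
have sgP x := semigroup_bounded x u0 mg g0 gC.
have [T TE] := ex_semigroup_L2 mp inv.
rewrite (@le_trans _ _ (\int[nu]_x (semigroup P X u g x)%:E)%E)//.
  rewrite le_eqVlt; apply/orP; left; apply/eqP; apply: eq_integral => x _.
  have [-> _ _] := sgP x; apply: eq_integral => w _.
  by rewrite /= gE.
have sg0 x : 0 <= semigroup P X u g x by have [] := sgP x.
have sgC x : semigroup P X u g x <= C by have [] := sgP x.
have msg : measurable_fun setT (semigroup P X u g) by exact: measurable_semigroup.
rewrite (le_trans (integral_density_le numu msg sg0 sgC))// NE.
rewrite -(TE u g u0) Lnorm2E -EFinM lee_fin.
have N0 : 0 <= N by rewrite -lee_fin -NE Lnorm_ge0.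
rewrite ler_wpM2l// ler_wsqrtr// (le_trans _ gB)//.
exact: (T_le mp inv TE).
Qed.

(** Chernoff's bound at a fixed mesh, followed by the limit of vanishing mesh:
    the bound obtained at mesh [t / n.+1] exceeds the claim by a factor at most
    [expR eta] once [n] is large. *)
Lemma law_deviation_le (N t c : R) : 0 < t -> 'N[mu]_2%:E[density]%E = N%:E ->
  (law P nu [set w | (c <= \int[leb]_(s in `[0, t]) v (X s w))%R] <=
   (N * (Num.sqrt 2 * expR (t * Lam - c)))%:E)%E.
Proof.
move=> t0 NE; set A := [set w | _].
have N0 : 0 <= N by rewrite -lee_fin -NE Lnorm_ge0.
have mI := measurable_path_integral mp mv vk (ltW t0).
have mA : measurable A.
  rewrite (_ : A = (fun w => \int[leb]_(s in `[0, t]) v (X s w)) @^-1` `[c, +oo[%classic).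
    by rewrite -[X in measurable X]setTI; exact: mI.
  by apply/seteqP; split => w /=; rewrite in_itv/= andbT.
have pfin : law P nu A \is a fin_num by exact: fin_num_measure.
have p1 : fine (law P nu A) <= 1.
  by rewrite -lee_fin fineK// probability_le1.
rewrite -(fineK pfin) lee_fin; set p := fine _ in p1 *.
have p0 : 0 <= p by rewrite fine_ge0.
apply/ler_addgt0Pr => eta eta0.
pose C := mesh_error k Lam.
have C0 : 0 <= C by exact: mesh_error_ge0.
(* a mesh below m satisfies the requirements of growth_le and drift_expR, and
   makes the error term of sqrt_growth_le at most eta *)
pose m := Num.min (Num.min 1 (2^-1 / (k + 1))) (eta / (t * C + 1)).
have tC : 0 < t * C + 1 by rewrite ltr_wpDl// mulr_ge0// ltW.
have k1 : 0 < k + 1 by rewrite ltr_wpDl.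
have m0 : 0 < m by rewrite !lt_min ltr01 !divr_gt0.
have [n nP] : exists n, t / m < n.+1%:R.
  by exists (Num.trunc (t / m)); rewrite truncnS_gt.
pose h := t / n.+1%:R.
have h0 : 0 < h by rewrite divr_gt0.
have nh : n.+1%:R * h = t by rewrite /h mulrCA divff ?mulr1// pnatr_eq0.
have hm : h <= m by rewrite ler_pdivrMr// mulrC -ler_pdivrMr// ltW.
have h1 : h <= 1 by rewrite (le_trans hm)// !ge_min lexx.
have hk : h * k <= 2^-1.
  have : h * (k + 1) <= 2^-1.
    by rewrite -ler_pdivlMr// (le_trans hm)// !ge_min lexx orbT.
  by have := ltW h0; lra.
have heta : h * (t * C + 1) <= eta.
  by rewrite -ler_pdivlMr// (le_trans hm)// ge_min lexx orbT.
have := exp_moment_le n.+1 h0 hk NE; rewrite nh => moment.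
have markov : ((p * expR c)%R%:E <=
    \int[law P nu]_w (expR (\int[leb]_(s in `[0%R, t]) v (X s w)))%:E)%E.
  rewrite mulrC EFinM (fineK pfin) -(@integral_cst _ _ _ (law P nu) A mA).
  rewrite -integral_indic_mul; apply: ge0_le_integral => //.
  - by move=> w _; rewrite mule_ge0// lee_fin ?expR_ge0.
  - apply: emeasurable_funM => //; exact/measurable_EFinP.
  - by apply/measurable_EFinP; apply: measurableT_comp.
  - move=> w _; rewrite indicE; have [wA|_] := boolP (w \in A).
      by rewrite mul1e lee_fin ler_expR; move: wA; rewrite inE.
    by rewrite mul0e lee_fin expR_ge0.
have := le_trans markov moment; rewrite lee_fin => pc.
set D := N * (Num.sqrt 2 * expR (t * Lam - c)).
have D0 : 0 <= D by rewrite !mulr_ge0 ?sqrtr_ge0 ?expR_ge0.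
have pD : p <= D * expR eta.
  have e1 : p = p * expR c * expR (- c) by rewrite -mulrA -expRD subrr expR0 mulr1.
  rewrite e1 (le_trans (ler_wpM2r (expR_ge0 _) pc))//.
  rewrite /D -!mulrA ler_wpM2l//.
  rewrite (le_trans (ler_wpM2r (expR_ge0 _) (sqrt_growth_le k0 Lam0 n.+1 (ltW h0) h1)))//.
  rewrite nh -[leLHS]mulrA ler_wpM2l ?sqrtr_ge0// -!expRD ler_expR.
  have : 0 <= t * C * h by rewrite !mulr_ge0// ltW.
  by move: heta; rewrite -/C; have := ltW h0; lra.
have : p * (1 - eta) <= D.
  have [e1|e1] := leP 0 (1 - eta); last by rewrite (le_trans _ D0)// mulr_ge0_le0// ltW.
  rewrite (le_trans (ler_wpM2r e1 pD))// -mulrA ler_piMr//.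
  rewrite (le_trans (ler_wpM2l (expR_ge0 eta) (expR_ge1Dx (- eta))))//.
  by rewrite -expRD subrr expR0.
have : p * eta <= eta by rewrite ler_piMl// ltW.
lra.
Qed.

End perturbed.
End deviation.
(** * The concentration inequality *)

Lemma sup_norm_ge (R : realType) (T : Type) (V : T -> R) x :
  bounded_fun V -> `|V x| <= sup_norm V.
Proof.
move=> [M [_ VM]]; apply: ub_le_sup; last by exists x.
exists (M + 1) => _ [y _ <-].
by have := VM (M + 1); rewrite ltrDl ltr01 => /(_ isT y I).
Qed.

(** After multiplication by [D / rho] the claim is the nonnegativity of a
    quadratic form in [n * y] and [r * x]. *)
Lemma rate_quadratic (R : realType) (rho n K r D x y : R) :
  D = 25 * n ^+ 2 + 6 * K * r -> 0 < D -> 0 <= rho ->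
  let lam := 2 * rho * r / D in
  5 / 2 * (lam * n) * (x * y) + 3 / 2 * (lam * (2 * K)) * y ^+ 2 <=
  rho * y ^+ 2 + rho * r ^+ 2 / D * x ^+ 2.
Proof.
move=> DE D0 rho0 /=; have Dn0 : D != 0 by rewrite gt_eqF.
rewrite -subr_ge0.
have -> : rho * y ^+ 2 + rho * r ^+ 2 / D * x ^+ 2 -
  (5 / 2 * (2 * rho * r / D * n) * (x * y) + 3 / 2 * (2 * rho * r / D * (2 * K)) * y ^+ 2)
  = rho / D * (D * y ^+ 2 + r ^+ 2 * x ^+ 2 - 5 * r * n * (x * y) - 6 * K * r * y ^+ 2).
  by field.
rewrite mulr_ge0//; first by rewrite divr_ge0// ltW.
rewrite DE; have := sqr_ge0 (r * x - 5 / 2 * (n * y)); have := sqr_ge0 (n * y).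
by nra.
Qed.

Section time_average.
Context d (E : measurableType d) dW (W : measurableType dW) (R : realType).
Variables (P : R.-pker E ~> W) (X : R -> W -> E) (V : E -> R) (K : R).
Hypotheses (mp : markov_process P X) (mV : measurable_fun setT V).
Hypothesis VK : forall y, `|V y| <= K.
Local Notation leb := (@lebesgue_measure R).

Lemma measurable_deviation t m r : 0 <= t ->
  measurable [set w | (time_average X V t w - m >= r)%R].
Proof.
move=> t0; have mI := measurable_path_integral mp mV VK t0.
have mF : measurable_fun setT (fun w => time_average X V t w - m).
  by apply: measurable_funB => //; exact: measurable_funM.
rewrite (_ : [set w | _] =
    (fun w => time_average X V t w - m) @^-1` `[r, +oo[%classic).
  by rewrite -[X in measurable X]setTI; exact: mF.
by apply/seteqP; split => w /=; rewrite in_itv/= andbT.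
Qed.

Lemma path_integral_affine (lam m t : R) w : 0 <= t ->
  \int[leb]_(s in `[0, t]) (lam * (V (X s w) - m)) =
  lam * (\int[leb]_(s in `[0, t]) V (X s w) - t * m).
Proof.
move=> t0; rewrite (path_integralE X V).
have iV := integrable_path mp mV VK t w.
have ic (c : R) : leb.-integrable `[0, t] (EFin \o cst c).
  exact: (@bounded_integrable_itv _ (cst c) `|c|).
transitivity (\int[leb]_(s in `[0, t]) (lam * path_value X V (s, w) - lam * m)).
  apply: eq_Rintegral => s; rewrite inE/= in_itv/= => /andP[s0 _].
  by rewrite path_valueE// mulrBr.
rewrite (RintegralB _ (integrableZl _ lam iV) (ic (lam * m)))//.
rewrite RintegralZl// Rintegral_cst//= lebesgue_measure_itv/= lte_fin.
case: ltgtP t0 => [t1 _|//|<- _]; last by rewrite mulr0 mul0r !subr0.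
by rewrite -EFinB/= subr0; ring.
Qed.

End time_average.

Theorem mainTheorem1 (R : realType) (E : ptopologicalType)
    (dW : measure_display) (W : measurableType dW)
    (P : R.-pker (borel E) ~> W) (X : R -> W -> borel E)
    (mu : probability (borel E) R)
    (rho : R) (S : L2 mu -> L2 mu) :
  polish R E ->
  markov_process P X ->
  conservative P X ->
  invariant_probability P X mu ->
  generator_dense P X mu ->
  generator_closed P X mu ->
  0 < rho ->
  bounded_symmetric_operator S ->
  (forall f Lf : L2 mu, generator P X f Lf ->
     norm2 mu (S f) <= 2^-1 * norm2 mu (centered mu f) /\
     dot mu f (Lf \+ S Lf) <= - rho * norm2 mu (centered mu f) ^+ 2) ->
  forall (nu : probability (borel E) R) (V : borel E -> R),
    nu `<< mu ->
    measurable_fun setT V ->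
    bounded_fun V ->
    forall t r : R, 0 <= t -> 0 <= r ->
      (law P nu [set w : W | (time_average X V t w - mean mu V >= r)%R]
       <= (Num.sqrt 2)%:E
          * 'N[mu]_2%:E['d (charge_of_finite_measure nu) '/d mu]
          * (expR (- (t * rate mu rho V r)))%:E)%E.
Proof.
move=> _ mp cons inv dens _ rho0 Sbso S_gen nu V numu mV bV t r t0 r0.
set A := [set w | _]; set N := ('N[mu]_2%:E[_])%E.
pose K := sup_norm V.
have VK y : `|V y| <= K by exact: sup_norm_ge.
have K0 : 0 <= K := le_trans (normr_ge0 _) (VK point).
have N1 : (1 <= N)%E by exact: density_norm_ge1.
have mA : measurable A by exact: (measurable_deviation mp mV VK).
have sqrt2 : 1 <= Num.sqrt 2 :> R by rewrite -{1}sqrtr1 ler_wsqrtr// ler1n.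
have s20 : 0 < Num.sqrt 2 :> R by exact: lt_le_trans sqrt2.
have [Ny|NE] : N = +oo%E \/ exists Nr, N = Nr%:E.
  by case: N N1 => [n _| |//]; [right; exists n|left].
  rewrite Ny mulry gtr0_sg// mul1e mulyr gtr0_sg ?expR_gt0// mul1e.
  exact: leey.
have {NE}[Nr NE] := NE.
have Nr1 : 1 <= Nr by rewrite -lee_fin -NE.
pose D := 25 * norm2 mu V ^+ 2 + 6 * K * r.
have D0 : 0 <= D by apply: addr_ge0; [rewrite mulr_ge0 ?sqr_ge0|rewrite !mulr_ge0].
rewrite NE -!EFinM.
(* when t, r or the denominator vanishes, the bound is at least 1 *)
have trivial : t * rate mu rho V r = 0 ->
    (law P nu A <= (Num.sqrt 2 * Nr * expR (- (t * rate mu rho V r)))%:E)%E.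
  move=> ->; rewrite oppr0 expR0 mulr1.
  by rewrite (le_trans (probability_le1 (law P nu) mA))// lee_fin mulr_ege1.
have [t00|tn0] := eqVneq t 0; first by apply: trivial; rewrite t00 mul0r.
have [r00|rn0] := eqVneq r 0.
  by apply: trivial; rewrite /rate r00 expr0n/= mulr0 mul0r mulr0.
have [D00|Dn0] := eqVneq D 0.
  by apply: trivial; rewrite /rate -/K -/D D00 invr0 !mulr0.
have t_gt0 : 0 < t by rewrite lt0r tn0.
have r_gt0 : 0 < r by rewrite lt0r rn0.
have D_gt0 : 0 < D by rewrite lt0r Dn0.
(* with this tilt and Lam := rho r^2 / D the exponent t Lam - lam t r is
   - t rho r^2 / D *)
pose lam := 2 * rho * r / D.
have lam0 : 0 < lam by rewrite divr_gt0// !mulr_gt0.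
have [e eE] := ex_L2_cst mu 1.
have [M ME] := ex_multiplication mu mV VK.
pose q := fun f g : L2 mu => dot mu f g.
have sfq : symmetric_bilinear q := sf_dot mu.
have q_ge0 : forall f, 0 <= q f f := @dot_ge0 _ _ _ mu.
have qee : q e e = 1 := dot_unit eE.
have V2E : M e = V :> (borel E -> R).
  by rewrite ME; apply/funext => x; rewrite eE/= mulr1.
pose v := lam *: (M e - avg q e (M e) *: e).
have vE x : v x = lam * (V x - mean mu V).
  rewrite -[LHS]/(lam * (M e x - avg q e (M e) * e x)).
  by rewrite avg_mean// V2E eE/= mulr1.
(* so centering at most doubles the sup norm *)
have meanVK : `|mean mu V| <= K.
  rewrite -ler_sqr ?nnegrE// real_normK ?num_real//.
  rewrite -[in mean _ _]V2E -(avg_mean eE) (le_trans (avg2_le sfq q_ge0 qee _))//.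
  rewrite -lee_fin dotE.
  have := integral_sqr_mul_le mV VK e; rewrite -/(q e e) qee mulr1.
  by apply: le_trans; rewrite le_eqVlt; apply/orP; left; apply/eqP/eq_integral
    => x _; rewrite V2E eE/= mulr1 expr2.
have vk x : `|v x| <= lam * (2 * K).
  rewrite vE normrM gtr0_norm// ler_pM2l// (le_trans (ler_normB _ _))//.
  by rewrite mulr_natl mulr2n lerD.
have mv : measurable_fun setT v := measurable_L2 v.
have v_mean : mean mu v = 0.
  rewrite -(avg_mean eE) -[LHS]/(q e v) /v (sf_scaler sfq).
  by rewrite -[X in _ * X]/(avg q e _) avg_center// mulr0.
have v_norm : norm2 mu v <= lam * norm2 mu V.
  rewrite -V2E !norm2E (seminormZ sfq) gtr0_norm// ler_pM2l//.
  by rewrite (seminorm_center sfq qee) sqrt_var_le.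
have Lam0 : 0 <= rho * r ^+ 2 / D by rewrite divr_ge0 ?mulr_ge0 ?sqr_ge0 ?ltW.
have rq x y (_ : 0 <= x) (_ : 0 <= y) :=
  rate_quadratic (n := norm2 mu V) (K := K) (r := r) x y erefl D_gt0 (ltW rho0).
have AE : A = [set w | lam * (t * r) <=
    \int[lebesgue_measure]_(s in `[0, t]) v (X s w)].
  apply/funext => w; rewrite /A/=; congr (is_true _).
  have -> : \int[lebesgue_measure]_(s in `[0, t]) v (X s w) =
      \int[lebesgue_measure]_(s in `[0, t]) (lam * (V (X s w) - mean mu V)).
    by apply: eq_Rintegral => s _; exact: vE.
  rewrite (path_integral_affine mp mV VK)// ler_pM2l// /time_average.
  by rewrite !lerBrDr -mulrDr ler_pdivlMl.
rewrite AE (le_trans (law_deviation_le mp cons inv dens rho0 Sbso S_gen mv vk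
  v_mean v_norm Lam0 rq numu (lam * (t * r)) t_gt0 NE))// lee_fin.
have -> : t * (rho * r ^+ 2 / D) - lam * (t * r) = - (t * rate mu rho V r).
  by rewrite /rate -/K -/D /lam; field.
by rewrite mulrCA mulrA.
Qed.
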